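(* Let $M$ be a smooth manifold, let $\mathcal F: M\to \mathrm{Sym}_n(\mathbb F)$ be a smooth family, and let $x\in M$ be a point at which the eigenvalue $\lambda_k$ has multiplicity $\nu\ge 1$. The following two conditions are equivalent: (i) $\mathrm{Ran}\,\mathcal H_x$ contains a positive definite matrix; (ii) $\left(\mathrm{Ran}\,\mathcal H_x\right)^\perp\cap \mathrm{Sym}_\nu^+=\{0\}$. If these conditions hold, then $x$ is a topologically regular point of the function $\lambda_k:M\to\mathbb R$.
   Context: $\mathbb F$ is $\mathbb R$ or $\mathbb C$, and $\mathrm{Sym}_n=\mathrm{Sym}_n(\mathbb F)$ is the real vector space of $n\times n$ real symmetric (if $\mathbb F=\mathbb R$) or complex Hermitian (if $\mathbb F=\mathbb C$) matrices. The eigenvalues of $A\in\mathrm{Sym}_n$ are numbered with multiplicity in increasing order, $\widehat\lambda_1(A)\le\dots\le\widehat\lambda_n(A)$. A smooth family on a smooth finite-dimensional manifold $M$ is a $C^\infty$ map $\mathcal F:M\to\mathrm{Sym}_n$, and $\lambda_k:=\widehat\lambda_k\circ\mathcal F$, $1\le k\le n$. Compactness of $M$ is not required here. The multiplicity $\nu$ of $\lambda_k$ at $x$ is the multiplicity of $\lambda_k(x)$ as an eigenvalue of $\mathcal F(x)$, and $\mathbf E_k\subset\mathbb F^n$, $\dim \mathbf E_k=\nu$, is the corresponding eigenspace. Fix a linear isometry $\mathcal U:\mathbb F^\nu\to\mathbb F^n$ with range $\mathbf E_k$. The real-linear operator $\mathcal H_x:T_xM\to\mathrm{Sym}_\nu(\mathbb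 F)$ is $\mathcal H_x v:=\mathcal U^*\big(d\mathcal F(x)v\big)\mathcal U$. It depends on $\mathcal U$ only up to unitary conjugation, and the conditions used are independent of this choice. $\mathrm{Sym}_\nu^{+}$ is the set of positive semidefinite matrices in $\mathrm{Sym}_\nu$ (all eigenvalues non-negative); a matrix in $\mathrm{Sym}_\nu$ is positive definite if all its eigenvalues are strictly positive. $S^\perp$ is the orthogonal complement of a subspace $S$ in $\mathrm{Sym}_\nu$ with respect to the Frobenius inner product $\langle X,Y\rangle=\mathrm{Tr}(XY)$. For a continuous function $\phi:M\to\mathbb R$, a neighborhood $U$ of $x$ (always assumed homeomorphic to a ball) and $\epsilon>0$, put $U_x^{-\epsilon}(\phi):=\{y\in U:\phi(y)\le\phi(x)-\epsilon\}$ and $U_x^{+\epsilon}(\phi):=\{y\in U:\phi(y)\le\phi(x)+\epsilon\}$. The point $x$ is a topologically regular point of $\phi$ if there exists a small enough neighborhood $U$ of $x$ in $M$ and $\epsilon>0$ such that $U_x^{-\epsilon}(\phi)$ is a strong deformation retract of $U_x^{+\epsilon}(\phi)$. *)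

(* Defs.v *)
From HB Require Import structures.
From mathcomp Require Import all_boot all_order all_algebra complex.
From mathcomp Require Import all_classical all_reals all_analysis.

Set Implicit Arguments.
Unset Strict Implicit.
Unset Printing Implicit Defensive.

Import Order.TTheory GRing.Theory Num.Theory.
Import numFieldNormedType.Exports.

Local Open Scope classical_set_scope.
Local Open Scope ring_scope.

Inductive base_field := BaseR | BaseC.

Definition scalarF (R : realType) (K : base_field) : numFieldType :=
  match K with
  | BaseR => (R : numFieldType)
  | BaseC => (R[i] : numFieldType)
  end.

Section Matrices.
Variables (R : realType) (K : base_field).

Definition conjF : scalarF R K -> scalarF R K :=
  match K return scalarF R K -> scalarF R K with
  | BaseR => fun a : R => a
  | BaseC => fun z : R[i] => conjc z
  end.

Definition reF : scalarF R K -> R :=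
  match K return scalarF R K -> R with
  | BaseR => fun a : R => a
  | BaseC => fun z : R[i] => complex.Re z
  end.

Definition imF : scalarF R K -> R :=
  match K return scalarF R K -> R with
  | BaseR => fun _ => 0
  | BaseC => fun z : R[i] => complex.Im z
  end.

(* The scalar a + i b; over the reals the second component, which is always 0
   where this is used, is dropped. *)
Definition mkF (a b : R) : scalarF R K :=
  match K return scalarF R K with
  | BaseR => (a : R)
  | BaseC => (Complex a b : R[i])
  end.

Definition realF (a : R) : scalarF R K := mkF a 0.

Definition adjoint m n (A : 'M[scalarF R K]_(m, n)) : 'M[scalarF R K]_(n, m) :=
  map_mx conjF A^T.

Definition SymF n : set 'M[scalarF R K]_n := [set A | adjoint A = A].

(* The roots of the characteristic polynomial, repeated with multiplicity and
   in increasing order.  The default value [::] is only taken when some root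
   is not real, which does not happen on SymF n. *)
Definition eigvals n (A : 'M[scalarF R K]_n) : seq R :=
  xget [::] [set s : seq R | sorted <=%R s /\
    char_poly A = \prod_(a <- s) ('X - (realF a)%:P)].

(* 0-based: lambda_hat A 0 is the smallest eigenvalue. *)
Definition lambda_hat n (A : 'M[scalarF R K]_n) (k : nat) : R := (eigvals A)`_k.

Definition multiplicity n (A : 'M[scalarF R K]_n) (a : R) : nat :=
  count_mem a (eigvals A).

Definition right_eigenspace n (A : 'M[scalarF R K]_n) (a : R) : set 'cV[scalarF R K]_n :=
  [set v | A *m v = realF a *: v].

Definition isometry_onto n nu (U : 'M[scalarF R K]_(n, nu)) (E : set 'cV[scalarF R K]_n) :=
  adjoint U *m U = 1%:M /\ range (fun w : 'cV[scalarF R K]_nu => U *m w) = E.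

Definition posdef n : set 'M[scalarF R K]_n :=
  [set A | SymF A /\ forall a, eigenvalue A a -> 0 < a].

Definition SymF_plus n : set 'M[scalarF R K]_n :=
  [set A | SymF A /\ forall a, eigenvalue A a -> 0 <= a].

Definition frobenius_orth n (S : set 'M[scalarF R K]_n) : set 'M[scalarF R K]_n :=
  [set Y | SymF Y /\ forall X, S X -> \tr (X *m Y) = 0].

End Matrices.

Section Smoothness.
Variables (R : realType) (V W : normedModType R).

(* f is C^(k+1) on the open set A when it is differentiable on A with C^k
   differential; in finite dimension the latter means that all directional
   derivatives 'D_v f are C^k. *)
Fixpoint Ck (k : nat) (A : set V) (f : V -> W) : Prop :=
  match k with
  | 0 => forall u, A u -> {for u, continuous f}
  | k'.+1 => (forall u, A u -> differentiable f u) /\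
             (forall v : V, Ck k' A (fun u => 'D_v f u))
  end.

Definition smooth_on (A : set V) (f : V -> W) := forall k, Ck k A f.

End Smoothness.

Section Topology.
Variables (S T : topologicalType).

Definition homeomorphism_on (A : set S) (B : set T) (f : S -> T) (g : T -> S) :=
  [/\ forall x, A x -> B (f x) /\ g (f x) = x,
      forall y, B y -> A (g y) /\ f (g y) = y,
      {within A, continuous f} &
      {within B, continuous g}].

End Topology.

Definition strong_deformation_retract (R : realType) (T : topologicalType)
    (A X : set T) :=
  A `<=` X /\
  exists H : R * T -> T,
    [/\ {within [set t | 0 <= t <= 1] `*` X, continuous H},
        forall t y, 0 <= t <= 1 -> X y -> X (H (t, y)),
        forall y, X y -> H (0, y) = y,
        forall y, X y -> A (H (1, y)) &
        forall t y, 0 <= t <= 1 -> A y -> H (t, y) = y].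

Section Manifolds.
Variables (R : realType) (d : nat).

(* The maps to_chart and of_chart are total functions, meaningful only on
   chart_dom and chart_cod respectively. *)
Record chart (M : topologicalType) := Chart {
  chart_dom : set M;
  chart_cod : set 'rV[R]_d;
  to_chart : M -> 'rV[R]_d;
  of_chart : 'rV[R]_d -> M;
  chart_dom_open : open chart_dom;
  chart_cod_open : open chart_cod;
  chart_homeo : homeomorphism_on chart_dom chart_cod to_chart of_chart
}.

Definition transition (M : topologicalType) (c c' : chart M) :
  'rV[R]_d -> 'rV[R]_d := to_chart c' \o of_chart c.

Record smooth_manifold := SmoothManifold {
  carrier :> topologicalType;
  manifold_hausdorff : hausdorff_space carrier;
  manifold_second_countable : @second_countable carrier;
  atlas : set (chart carrier);
  atlas_cover : forall x : carrier, exists c, atlas c /\ chart_dom c x;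
  atlas_smooth : forall c c', atlas c -> atlas c' ->
    smooth_on (chart_cod c `&` of_chart c @^-1` chart_dom c') (transition c c')
}.

Variable M : smooth_manifold.

Definition chart_around (x : M) (c : chart M) := atlas c /\ chart_dom c x.

Definition chart_at (x : M) : chart M := sval (cid (atlas_cover x)).

(* A tangent vector at x is given by its coordinates v c in all charts c around
   x, which must transform by the differentials of the transition maps.  The
   irrelevant coordinates (c not around x) are set to 0, so that the tangent
   space is a d-dimensional linear subspace of chart M -> 'rV[R]_d. *)
Definition tangent_space (x : M) : set (chart M -> 'rV[R]_d) :=
  [set v | (forall c, ~ chart_around x c -> v c = 0) /\
           (forall c c', chart_around x c -> chart_around x c' ->
              v c' = 'd (transition c c') (to_chart c x) (v c))].

Definition smooth_function (f : M -> R) :=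
  forall c : chart M, atlas c -> smooth_on (chart_cod c) (f \o of_chart c).

(* Independent of the chart around x used to compute it. *)
Definition differential (f : M -> R) (x : M) (v : chart M -> 'rV[R]_d) : R :=
  'd (f \o of_chart (chart_at x)) (to_chart (chart_at x) x) (v (chart_at x)).

Definition topologically_regular (phi : M -> R) (x : M) :=
  exists (U : set M) (eps : R),
    [/\ nbhs x U,
        (* balls of 'rV[R]_d are for the sup norm: open cubes, homeomorphic to
           Euclidean balls *)
        exists f g, homeomorphism_on U (ball (0 : 'rV[R]_d) 1) f g,
        0 < eps &
        strong_deformation_retract R
          (U `&` [set y | phi y <= phi x - eps])
          (U `&` [set y | phi y <= phi x + eps])].

Variables (K : base_field) (n : nat).
Local Notation F := (scalarF R K).

Definition smooth_family (A : M -> 'M[F]_n) :=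
  (forall y, SymF (A y)) /\
  (forall i j, smooth_function (fun y => reF (A y i j)) /\
               smooth_function (fun y => imF (A y i j))).

Definition family_differential (A : M -> 'M[F]_n) (x : M)
    (v : chart M -> 'rV[R]_d) : 'M[F]_n :=
  \matrix_(i, j) mkF K (differential (fun y => reF (A y i j)) x v)
                       (differential (fun y => imF (A y i j)) x v).

Definition lambda (A : M -> 'M[F]_n) (k : nat) (y : M) : R :=
  lambda_hat (A y) k.

Definition Hop (A : M -> 'M[F]_n) (x : M) nu (U : 'M[F]_(n, nu))
    (v : chart M -> 'rV[R]_d) : 'M[F]_nu :=
  adjoint U *m family_differential A x v *m U.

Definition RanH (A : M -> 'M[F]_n) (x : M) nu (U : 'M[F]_(n, nu)) :
  set 'M[F]_nu := Hop A x U @` tangent_space x.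

End Manifolds.

(* Main.v *)
(* Around a point [y] near [x], compare the matrices at [y] and at [y + s v], where
   [v] is a direction in which the derivative [D] of the family is positive
   definite on the eigenspace.  By Finsler's lemma [D + tau (A(x) - lambda)^2] is
   positive definite for large [tau]; up to [o(s)], [s] times it is what
   [A(y + s v) - mu], after congruence by [1 + s (tau / 2) (A(x) - lambda)], gains
   over [A(y) - mu].  Congruences preserve inertia, hence [lambda_k] strictly
   increases along [v] throughout a neighbourhood of [x], without any study of the
   eigenspaces.  In a box that is long in the direction [v], sliding down along [v] until
   [lambda_k = lambda_k(x) - eps] is a strong deformation retraction.

   The equivalence is a theorem of the alternative: if no matrix of the range is
   positive definite, the largest eigenvalue is a sublinear functional that is
   nonnegative on the range, and a Hahn-Banach extension of the zero functional
   below it is the trace pairing with a nonzero positive semidefinite matrix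
   orthogonal to the range.

   The cases R and C are treated together by viewing matrices as complex ones;
   quadratic forms are evaluated on row vectors, as [w A w^*]. *)
From HB Require Import structures.
Require Import Defs.
From mathcomp Require Import all_boot all_order all_algebra complex.
From mathcomp Require Import all_classical all_reals all_analysis.
From mathcomp Require Import spectral sesquilinear.
From mathcomp Require Import ring lra.

Set Implicit Arguments.
Unset Strict Implicit.
Unset Printing Implicit Defensive.

Import Order.TTheory GRing.Theory Num.Theory.
Import numFieldNormedType.Exports.

Local Open Scope classical_set_scope.
Local Open Scope ring_scope.

(** * Complexification and the spectral theorem *)

Section Complexification.
Variable R : realType.
Local Notation C := R[i].

Definition cplF (K : base_field) (a : scalarF R K) : C :=
  Complex (reF a) (imF a).

Lemma cplF_is_zmod_morphism K : zmod_morphism (@cplF K).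
Proof.
case: K => /= [a b|[a b] [c d]]; rewrite /cplF //=; apply/eqP.
by rewrite eq_complex /= subrr !eqxx.
Qed.

Lemma cplF_is_monoid_morphism K : monoid_morphism (@cplF K).
Proof.
case: K; split => //= a b; rewrite /cplF.
  by apply/eqP; rewrite eq_complex /= !mulr0 !mul0r subr0 addr0 !eqxx.
by case: a b => [? ?] [? ?].
Qed.

HB.instance Definition _ K := GRing.isZmodMorphism.Build _ _ (@cplF K)
  (@cplF_is_zmod_morphism K).
HB.instance Definition _ K := GRing.isMonoidMorphism.Build _ _ (@cplF K)
  (@cplF_is_monoid_morphism K).

Lemma cplF_realF K (a : R) : cplF (realF K a) = a%:C%C.
Proof. by case: K. Qed.

Lemma cplF_conjF K (a : scalarF R K) : cplF (conjF a) = (cplF a)^*.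
Proof.
by case: K a => [a|[a b]] //=; rewrite /cplF /=; apply/eqP; rewrite eq_complex /= oppr0 !eqxx.
Qed.

Definition cplmx K m n (A : 'M[scalarF R K]_(m, n)) : 'M[C]_(m, n) :=
  map_mx (@cplF K) A.

Definition hadj m n (A : 'M[C]_(m, n)) : 'M[C]_(n, m) := map_mx Num.conj A^T.

Lemma cplmx_adjoint K m n (A : 'M[scalarF R K]_(m, n)) :
  cplmx (adjoint A) = hadj (cplmx A).
Proof. by apply/matrixP => i j; rewrite !mxE cplF_conjF. Qed.
End Complexification.

Section Spectrum.
Variable R : realType.
Local Notation C := R[i].

Lemma hadjM m n p (A : 'M[C]_(m, n)) (B : 'M[C]_(n, p)) :
  hadj (A *m B) = hadj B *m hadj A.
Proof. by rewrite /hadj trmx_mul map_mxM. Qed.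

Lemma hadjK m n (A : 'M[C]_(m, n)) : hadj (hadj A) = A.
Proof. exact: trmxCK. Qed.

Lemma hadjD m n (A B : 'M[C]_(m, n)) : hadj (A + B) = hadj A + hadj B.
Proof. by apply/matrixP => i j; rewrite !mxE rmorphD. Qed.

Lemma hadjZ m n (a : R) (A : 'M[C]_(m, n)) : hadj (a%:C%C *: A) = a%:C%C *: hadj A.
Proof.
by apply/matrixP => i j; rewrite !mxE rmorphM; congr (_ * _); exact: conjc_real.
Qed.

Lemma hadj_scalar n (a : R) : hadj (a%:C%C)%:M = (a%:C%C)%:M :> 'M[C]_n.
Proof.
apply/matrixP => i j; rewrite !mxE rmorphMn eq_sym; congr (_ *+ _).
exact: conjc_real.
Qed.

(** The rows of [P] form an orthonormal eigenbasis. The spectral theorem for normal matrices yields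
    a complex diagonal; Hermitian symmetry makes it real. *)
Lemma herm_spectral n (A : 'M[C]_n) : hadj A = A ->
  exists (P : 'M[C]_n) (d : 'rV[R]_n), [/\ P *m hadj P = 1%:M,
    hadj P *m P = 1%:M &
    A = hadj P *m diag_mx (map_mx (real_complex R) d) *m P].
Proof.
move=> hA; have Aherm : A \is hermsymmx.
  by apply/is_hermitianmxP; rewrite expr0 scale1r -[LHS]hA.
have /orthomx_spectralP eA := hermitian_normalmx Aherm.
have uP := spectral_unitarymx A.
have hP : invmx (spectralmx A) = hadj (spectralmx A) := invmx_unitary uP.
exists (spectralmx A), (map_mx (@complex.Re R) (spectral_diag A)).
split; first exact/unitarymxP.
  by rewrite -hP mulVmx// spectral_unit.
rewrite -hP {1}eA; congr (_ *m diag_mx _ *m _).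
apply/rowP => i; rewrite !mxE.
have /mxOverP h := hermitian_spectral_diag_real Aherm.
by rewrite (RRe_real (h 0 i)).
Qed.

(** The real part only serves to land in [R]: for Hermitian [A] the value is real already. *)
Definition qf n (A : 'M[C]_n) (w : 'rV[C]_n) : R :=
  complex.Re ((w *m A *m hadj w) 0 0).

Definition nsq (a : C) : R := complex.Re a ^+ 2 + complex.Im a ^+ 2.

Lemma nsq_ge0 a : 0 <= nsq a.
Proof. by rewrite addr_ge0// sqr_ge0. Qed.

Lemma nsq_eq0 a : (nsq a == 0) = (a == 0).
Proof. by rewrite /nsq paddr_eq0 ?sqr_ge0// !sqrf_eq0 eq_complex. Qed.

Lemma ReD : {morph (@complex.Re R : C -> R) : x y / x + y}.
Proof. by case=> ? ? []. Qed.

Lemma Re_sum (I : Type) (r : seq I) (P : pred I) (F : I -> C) :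
  complex.Re (\sum_(i <- r | P i) F i) = \sum_(i <- r | P i) complex.Re (F i).
Proof. exact: (big_morph _ ReD erefl). Qed.

Lemma qfD n (A B : 'M[C]_n) w : qf (A + B) w = qf A w + qf B w.
Proof. by rewrite /qf mulmxDr mulmxDl mxE ReD. Qed.

Lemma ReZ (a : R) (x : C) : complex.Re (a%:C%C * x) = a * complex.Re x.
Proof. by case: x => b c /=; rewrite mul0r subr0. Qed.

Lemma qfZ n (a : R) (A : 'M[C]_n) w : qf (a%:C%C *: A) w = a * qf A w.
Proof. by rewrite /qf -scalemxAr -scalemxAl mxE ReZ. Qed.

Lemma qfB n (A B : 'M[C]_n) w : qf (A - B) w = qf A w - qf B w.
Proof.
have -> : A - B = A + (-1)%:C%C *: B by rewrite rmorphN rmorph1 scaleN1r.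
by rewrite qfD qfZ mulN1r.
Qed.

Lemma qf_diag n (d : 'rV[R]_n) (a : 'rV[C]_n) :
  qf (diag_mx (map_mx (real_complex R) d)) a = \sum_i d 0 i * nsq (a 0 i).
Proof.
rewrite /qf mxE Re_sum; apply: eq_bigr => i _.
rewrite mul_mx_diag !mxE mulrAC mulrC ReZ; congr (_ * _).
rewrite /nsq; case: (a 0 i) => x y /=.
by rewrite mulrN opprK.
Qed.

Lemma qf1 n (w : 'rV[C]_n) : qf 1%:M w = \sum_i nsq (w 0 i).
Proof.
have -> : 1%:M = diag_mx (map_mx (real_complex R) (const_mx 1)) :> 'M[C]_n.
  by rewrite map_const_mx diag_const_mx.
by rewrite qf_diag; apply: eq_bigr => i _; rewrite mxE mul1r.
Qed.

Lemma qf1_ge0 n (w : 'rV[C]_n) : 0 <= qf 1%:M w.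
Proof. by rewrite qf1 sumr_ge0// => i _; exact: nsq_ge0. Qed.

Lemma qf1_gt0 n (w : 'rV[C]_n) : w != 0 -> 0 < qf 1%:M w.
Proof.
move=> w0; rewrite lt_def qf1_ge0 andbT; apply: contra w0.
rewrite qf1 psumr_eq0 => [/allP h|i _]; last exact: nsq_ge0.
by apply/eqP/rowP => i; apply/eqP; rewrite mxE -nsq_eq0; apply: h.
Qed.

Lemma qf_scalar n (a : R) (w : 'rV[C]_n) : qf (a%:C%C)%:M w = a * qf 1%:M w.
Proof. by rewrite -qfZ scalemx1. Qed.

Lemma qf_mulmx m n (A : 'M[C]_n) (G : 'M[C]_(m, n)) w :
  qf (G *m A *m hadj G) w = qf A (w *m G).
Proof. by rewrite /qf hadjM !mulmxA. Qed.

(** The entries of [a] are the coordinates of [a *m P] in the eigenbasis given by the rows of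
    [P]. *)
Lemma qf_spectral n (P : 'M[C]_n) (d : 'rV[R]_n) (mu : R) (a : 'rV[C]_n) :
  P *m hadj P = 1%:M ->
  qf (hadj P *m diag_mx (map_mx (real_complex R) d) *m P - (mu%:C%C)%:M) (a *m P)
   = \sum_i (d 0 i - mu) * nsq (a 0 i).
Proof.
move=> PP; rewrite qfB qf_scalar -!qf_mulmx !mulmxA mulmx1 PP mul1mx -!mulmxA.
rewrite PP mulmx1 qf_diag qf1 mulr_sumr -sumrB; apply: eq_bigr => i _.
by rewrite mulrBl.
Qed.

Lemma char_poly_diag n (P : 'M[C]_n) (d : 'rV[C]_n) :
  hadj P *m P = 1%:M ->
  char_poly (hadj P *m diag_mx d *m P) = \prod_i ('X - (d 0 i)%:P).
Proof.
move=> PP; have e : char_poly_mx (hadj P *m diag_mx d *m P) =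
    map_mx polyC (hadj P) *m char_poly_mx (diag_mx d) *m map_mx polyC P.
  rewrite /char_poly_mx mulmxBr mulmxBl -!map_mxM/=; congr (_ - _).
  by rewrite scalar_mxC -mulmxA -map_mxM PP map_mx1 mulmx1.
rewrite /char_poly e !det_mulmx mulrAC -det_mulmx -map_mxM PP map_mx1 det1 mul1r.
rewrite -[LHS]/(char_poly _) char_poly_trig.
  by apply: eq_bigr => i _; rewrite mxE eqxx.
exact/diag_mx_is_trig.
Qed.

(** After complexification the characteristic polynomial splits over the entries of [d], and a
    product of monic linear factors determines its roots up to order. *)
Lemma eigvals_spectral K n (A : 'M[scalarF R K]_n) (P : 'M[C]_n) (d : 'rV[R]_n) :
  hadj P *m P = 1%:M ->
  cplmx A = hadj P *m diag_mx (map_mx (real_complex R) d) *m P ->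
  sorted <=%R (eigvals A) /\ perm_eq (eigvals A) [seq d 0 i | i : 'I_n].
Proof.
move=> PP eA.
have cA : map_poly (@cplF R K) (char_poly A) =
    \prod_(a <- [seq d 0 i | i : 'I_n]) ('X - (a%:C%C)%:P).
  rewrite map_char_poly/= -/(cplmx A) eA char_poly_diag// big_image/=.
  by apply: eq_bigr => i _; rewrite mxE.
have mapE (s : seq R) : map_poly (@cplF R K) (\prod_(a <- s) ('X - (realF K a)%:P))
    = \prod_(a <- s) ('X - (a%:C%C)%:P).
  rewrite rmorph_prod; apply: eq_bigr => a _.
  by rewrite rmorphB/= map_polyX map_polyC/= cplF_realF.
pose Q := [set s : seq R | sorted <=%R s /\
    char_poly A = \prod_(a <- s) ('X - (realF K a)%:P)].
have : Q (eigvals A).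
  (* The sorted diagonal is a witness, so [xget] does not fall back on its default value. *)
  apply: (@xgetI _ _ _ (sort <=%R [seq d 0 i | i : 'I_n])); split.
    by apply: sort_sorted; exact: le_total.
  apply: (@map_poly_inj _ _ (@cplF R K)).
  rewrite mapE; rewrite cA; apply: perm_big.
  by rewrite perm_sym perm_sort.
move=> [ss /(congr1 (map_poly (@cplF R K)))]; rewrite mapE cA => e.
split=> //; rewrite perm_sym.
apply: (perm_map_inj (@complexI R)); apply: prod_XsubC_eq.
by rewrite big_map [RHS]big_map -e.
Qed.

Section Counting.
Variables (n : nat) (d : 'rV[R]_n) (s : seq R).
Hypotheses (ss : sorted <=%R s) (sd : perm_eq s [seq d 0 i | i : 'I_n]).

Lemma card_count (P : pred R) : #|[set i | P (d 0 i)]%SET| = count P s.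
Proof.
rewrite (permP sd) -sum1_card -sum1_count big_map big_enum_cond.
by apply: eq_bigl => i; rewrite inE.
Qed.

Lemma size_spectrum : size s = n.
Proof. by rewrite (perm_size sd) size_map size_enum_ord. Qed.

Lemma card_ge_nth (k : 'I_n) : (n - k <= #|[set i | (s`_k <= d 0 i)%R]%SET|)%N.
Proof.
rewrite (card_count (fun x => s`_k <= x)) -{2}(cat_take_drop k s) count_cat.
apply: leq_trans (leq_addl _ _).
rewrite -{1}size_spectrum -size_drop leq_eqVlt; apply/orP; left; rewrite eq_sym.
rewrite -all_count; apply/(all_nthP 0) => i.
rewrite size_drop nth_drop => ilt.
have h : (k + i < size s)%N by rewrite -ltn_subRL.
apply: (sorted_leq_nth le_trans le_refl) => //; rewrite ?inE//.
- by rewrite size_spectrum.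
- exact: leq_addr.
Qed.

(** Indices start at 0, so [k.+1] entries of the sorted list are at most the one of index [k]: hence
    the strict inequality. *)
Lemma card_le_nth (k : 'I_n) mu : s`_k <= mu ->
  (k < #|[set i | (d 0 i <= mu)%R]%SET|)%N.
Proof.
move=> kmu; rewrite (card_count (fun x => x <= mu)) -(cat_take_drop k.+1 s) count_cat.
apply: leq_trans (leq_addr _ _).
have hs : size (take k.+1 s) = k.+1 by rewrite size_takel// size_spectrum.
rewrite -{1}hs leq_eqVlt; apply/orP; left; rewrite eq_sym -all_count.
apply/(all_nthP 0) => i; rewrite hs ltnS => ik.
rewrite nth_take ?ltnS//; apply: le_trans kmu.
apply: (sorted_leq_nth le_trans le_refl) => //; rewrite ?inE ?size_spectrum//.
- exact: leq_ltn_trans ik _.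
Qed.
End Counting.

(** The rows are the unit vectors indexed by [I]; multiplying a row vector by it extends
    coefficients on [I] by zero. *)
Definition coordmx n (I : {set 'I_n}) : 'M[C]_(#|I|, n) :=
  \matrix_(i, j) (enum_val i == j)%:R.

Lemma coordmx_supp n (I : {set 'I_n}) (a : 'rV[C]_#|I|) i :
  i \notin I -> (a *m coordmx I) 0 i = 0.
Proof.
move=> iI; rewrite mxE big1// => j _; rewrite mxE.
case: eqP => [e|]; last by rewrite mulr0.
by move: iI; rewrite -e enum_valP.
Qed.

Lemma coordmx_inj n (I : {set 'I_n}) (a : 'rV[C]_#|I|) :
  a *m coordmx I = 0 -> a = 0.
Proof.
move=> /rowP h; apply/rowP => j; have := h (enum_val j).
rewrite !mxE (bigD1 j)//= mxE eqxx mulr1 big1 ?addr0// => i ij.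
by rewrite mxE (inj_eq enum_val_inj) (negPf ij) mulr0.
Qed.

Lemma cplmx_herm K n (A : 'M[scalarF R K]_n) : SymF A -> hadj (cplmx A) = cplmx A.
Proof. by rewrite -cplmx_adjoint => ->. Qed.

(* Courant-Fischer in disguise: the eigenvectors of [A] for eigenvalues [>= mu]
   span a space of dimension [>= n - k]; if [lambda_k A'] were [<= mu'], those of
   [A'] for eigenvalues [<= mu'] would span a space of dimension [> k], and the
   image of the former under [G] would meet the latter. *)
Lemma lambda_hat_lt K n (A A' : 'M[scalarF R K]_n) (G : 'M[C]_n) (mu mu' : R)
    (k : 'I_n) :
  SymF A -> SymF A' -> mu <= lambda_hat A k ->
  (forall w, w != 0 -> qf (cplmx A - (mu%:C%C)%:M) w <
                       qf (cplmx A' - (mu'%:C%C)%:M) (w *m G)) ->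
  mu' < lambda_hat A' k.
Proof.
move=> sA sA' mul hlt; rewrite ltNge; apply/negP => lmu'.
have [P [d [PP' P'P eA]]] := herm_spectral (cplmx_herm sA).
have [Q [e [QQ' Q'Q eA']]] := herm_spectral (cplmx_herm sA').
have [ss sd] := eigvals_spectral P'P eA.
have [ss' sd'] := eigvals_spectral Q'Q eA'.
pose I := [set i | (mu <= d 0 i)%R]%SET; pose J := [set i | (e 0 i <= mu')%R]%SET.
have cI : (n - k <= #|I|)%N.
  apply: leq_trans (card_ge_nth ss sd k) _; apply: subset_leq_card.
  by apply/fintype.subsetP => i; rewrite !inE; exact: le_trans.
have cJ : (k < #|J|)%N by exact: (card_le_nth ss' sd').
pose M := col_mx (coordmx I *m P *m G) (- (coordmx J *m Q)).
have : kermx M != 0.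
  rewrite -mxrank_eq0 mxrank_ker subn_eq0 -ltnNge.
  apply: leq_ltn_trans (rank_leq_col _) _.
  have := leq_add cI cJ; apply: leq_trans.
  by rewrite addnS subnK// ltnW.
case/rowV0Pn => c /sub_kermxP cM c0.
move: cM; rewrite -(hsubmxK c) mul_row_col mulmxN !mulmxA => /subr0_eq.
set a := lsubmx c; set b := rsubmx c => ab.
have hI : 0 <= qf (cplmx A - (mu%:C%C)%:M) (a *m coordmx I *m P).
  rewrite eA qf_spectral//; apply: sumr_ge0 => i _.
  have [iI|iI] := boolP (i \in I).
    by rewrite mulr_ge0 ?nsq_ge0// subr_ge0; rewrite inE in iI.
  by rewrite coordmx_supp// /nsq /= !expr0n /= addr0 mulr0.
have hJ : qf (cplmx A' - (mu'%:C%C)%:M) (b *m coordmx J *m Q) <= 0.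
  rewrite eA' qf_spectral//; apply: sumr_le0 => i _.
  have [iI|iI] := boolP (i \in J).
    by rewrite mulr_le0_ge0 ?nsq_ge0// subr_le0; rewrite inE in iI.
  by rewrite coordmx_supp// /nsq /= !expr0n /= addr0 mulr0.
have cancelU (T : 'M[C]_n) (v : 'rV[C]_n) : T *m hadj T = 1%:M -> v *m T = 0 -> v = 0.
  by move=> h1 /(congr1 (mulmx^~ (hadj T))); rewrite mul0mx -mulmxA h1 mulmx1.
(* The strict hypothesis asks for a nonzero vector before [G] is applied; a zero one would force [a]
   and [b], hence the kernel vector [c], to vanish. *)
have [w0|w0] := eqVneq (a *m coordmx I *m P) 0.
  have a0 : a = 0 by apply: coordmx_inj; apply: cancelU w0.
  have b0 : b = 0.
    apply: coordmx_inj; apply: (cancelU Q) => //.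
    by rewrite -ab w0 mul0mx.
  by move: c0; rewrite -(hsubmxK c) -/a -/b a0 b0 row_mx0 eqxx.
have := hlt _ w0; rewrite ab => h.
by have := lt_le_trans (le_lt_trans hI h) hJ; rewrite ltxx.
Qed.
End Spectrum.

(** * Hahn-Banach and the theorem of the alternative *)

Section Separation.
Variables (R : realType) (V : lmodType R) (p : V -> R).
Hypotheses (pD : forall x y, p (x + y) <= p x + p y)
  (pZ : forall t x, 0 < t -> p (t *: x) <= t * p x).

(* Partial linear functionals on [V] are represented by their graphs. *)
Definition dominated_linrel (G : set (V * R)) :=
  [/\ G 0, forall t u v, G u -> G v -> G (t *: u + v) &
      forall u, G u -> u.2 <= p u.1].

(** The value at [e] must separate the numbers [u.2 - p (u.1 - e)] from the numbers
    [p (v.1 + e) - v.2]. Subadditivity of [p] puts the former below the latter, and their supremum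
    is such a value. *)
Lemma linrel_extend1 (G : set (V * R)) (e : V) : dominated_linrel G ->
  exists G' : set (V * R), [/\ dominated_linrel G', G `<=` G' & exists r, G' (e, r)].
Proof.
move=> [G0 GL Gp].
pose S := [set u.2 - p (u.1 - e) | u in G].
have Sub u v : G u -> G v -> u.2 - p (u.1 - e) <= p (v.1 + e) - v.2.
  move=> Gu Gv; rewrite lerBlDr addrAC lerBrDr.
  have := Gp _ (GL 1 _ _ Gu Gv); rewrite scale1r/= => /le_trans; apply.
  have -> : u.1 + v.1 = (v.1 + e) + (u.1 - e) by rewrite addrCA addrK addrC.
  exact: pD.
have S0 : S !=set0 by exists (0 - p (0 - e)); exists 0.
have a_ge u : G u -> u.2 - p (u.1 - e) <= sup S.
  move=> Gu; apply: ub_le_sup; last by exists u.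
  by exists (p (0 + e) - 0) => _ [v Gv <-]; exact: Sub Gv G0.
have a_le u : G u -> sup S <= p (u.1 + e) - u.2.
  by move=> Gu; apply: ge_sup => // _ [v Gv <-]; exact: Sub.
set a := sup S in a_ge a_le.
exists [set u + t *: (e, a) | t in [set: R] & u in G].
split; first split.
- by exists 0 => //; exists 0; rewrite ?scale0r ?addr0.
- move=> t _ _ [s _ [u Gu <-]] [s' _ [u' Gu' <-]].
  exists (t * s + s') => //; exists (t *: u + u'); first exact: GL.
  by rewrite scalerDl scalerDr scalerA addrACA.
(* For [t] nonzero, dividing by its absolute value reduces domination to one of the two bounds on
   [a], according to the sign of [t]. *)
- move=> _ [t _ [u Gu <-]] /=; rewrite -[t *: (a : R^o)]/(t * a).
  have [t0|t0|->] := ltgtP t 0; last first.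
  + by rewrite scale0r mul0r !addr0; exact: Gp.
  + have /a_le/= : G (t^-1 *: u + 0) by exact: GL.
    rewrite addr0/= -[t^-1 *: (u.2 : R^o)]/(t^-1 * u.2) addr0 lerBrDl => h.
    have := le_trans h _ => /(_ (t^-1 * p (u.1 + t *: e))).
    have e1 : t^-1 *: u.1 + e = t^-1 *: (u.1 + t *: e).
      by rewrite scalerDr scalerA mulVf ?gt_eqF// scale1r.
    rewrite e1 pZ ?invr_gt0// => /(_ isT).
    by rewrite ler_pdivlMl// mulrDr mulrA mulfV ?gt_eqF// mul1r.
  + have s0 : 0 < - t by rewrite oppr_gt0.
    have /a_ge/= : G ((- t)^-1 *: u + 0) by exact: GL.
    rewrite addr0/= -[(- t)^-1 *: (u.2 : R^o)]/((- t)^-1 * u.2) addr0 lerBlDr -lerBlDl => h.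
    have := le_trans h _ => /(_ ((- t)^-1 * p (u.1 + t *: e))).
    have e1 : (- t)^-1 *: u.1 - e = (- t)^-1 *: (u.1 + t *: e).
      rewrite scalerDr scalerA invrN mulNr mulVf ?lt_eqF//.
      by rewrite scaleN1r.
    rewrite e1 pZ ?invr_gt0// => /(_ isT).
    rewrite ler_pdivlMl// mulrBr mulrA mulfV ?gt_eqF// mul1r.
    by rewrite mulNr opprK.
- by move=> u Gu; exists 0 => //; exists u => //; rewrite scale0r addr0.
- by exists a; exists 1 => //; exists 0 => //; rewrite scale1r add0r.
Qed.

(** In finite dimension a finite spanning list is enough, so an induction on the list takes the
    place of Zorn's lemma. *)
Lemma linrel_extend (s : seq V) (G : set (V * R)) : dominated_linrel G ->
  exists G' : set (V * R), [/\ dominated_linrel G', G `<=` G' &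
    forall e, e \in s -> exists r, G' (e, r)].
Proof.
elim: s G => [|e s IH] G hG; first by exists G; split=> // e; rewrite in_nil.
have [G1 [hG1 GG1 [r er]]] := linrel_extend1 e hG.
have [G2 [hG2 GG2 h]] := IH _ hG1.
exists G2; split=> //; first exact: subset_trans GG2.
move=> x; rewrite inE => /predU1P[->|/h//].
by exists r; exact: GG2.
Qed.
End Separation.

(** * Quadratic forms on the unit sphere and Hahn-Banach for them *)

Section FormDuality.
Variable R : realType.
Local Notation C := R[i].

Lemma nsqM (a b : C) : nsq (a * b) = nsq a * nsq b.
Proof. by case: a b => [x y] [z t]; rewrite /nsq/=; ring. Qed.

Lemma nsq_conj (a : C) : nsq a^* = nsq a.
Proof. by case: a => x y; rewrite /nsq/= sqrrN. Qed.

Lemma qfE n (X : 'M[C]_n) w :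
  qf X w = \sum_j \sum_i complex.Re (w 0 i * X i j * (w 0 j)^*).
Proof.
rewrite /qf mxE Re_sum; apply: eq_bigr => j _.
by rewrite !mxE mulr_suml Re_sum.
Qed.

(** A crude bound, from [Re z <= 1 + |z|^2]; it ensures that the supremum of the form over the unit
    sphere exists. *)
Lemma qf_unit_le n (X : 'M[C]_n) w : qf 1%:M w = 1 ->
  qf X w <= \sum_j \sum_i (1 + nsq (X i j)).
Proof.
move=> w1; have wle i : nsq (w 0 i) <= 1.
  rewrite -w1 qf1 (bigD1 i)//= lerDl sumr_ge0// => *; exact: nsq_ge0.
rewrite qfE; apply: ler_sum => j _; apply: ler_sum => i _.
set z := _ * _; have : nsq z <= nsq (X i j).
  rewrite /z !nsqM nsq_conj mulrAC -[leRHS]mul1r ler_wpM2r ?nsq_ge0//.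
  by rewrite -[leRHS]mul1r ler_pM ?nsq_ge0.
rewrite /nsq; set x := complex.Re z; set y := complex.Im z; nra.
Qed.

Lemma qf0 n (w : 'rV[C]_n) : qf 0 w = 0.
Proof. by rewrite /qf mulmx0 mul0mx mxE. Qed.

Lemma qf_scale n (X : 'M[C]_n) (t : R) w :
  qf X (t%:C%C *: w) = t ^+ 2 * qf X w.
Proof.
rewrite /qf hadjZ -!scalemxAl -scalemxAr scalerA mxE -rmorphM ReZ.
by rewrite expr2.
Qed.

Lemma qf_normalize n (w : 'rV[C]_n) : w != 0 -> exists2 t : R, 0 < t &
  qf 1%:M (t%:C%C *: w) = 1.
Proof.
move=> /qf1_gt0 w0; exists (Num.sqrt (qf 1%:M w))^-1.
  by rewrite invr_gt0 sqrtr_gt0.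
by rewrite qf_scale exprVn sqr_sqrtr ?ltW// mulVf// gt_eqF.
Qed.

(** Sublinear in [X], being a supremum of real-linear functions of [X]. *)
Definition unit_form_sup n (X : 'M[C]_n) : R :=
  sup [set qf X w | w in [set w | qf 1%:M w = 1]].

Lemma qf_le_sup n (X : 'M[C]_n) w : qf 1%:M w = 1 -> qf X w <= unit_form_sup X.
Proof.
move=> w1; apply: ub_le_sup; last by exists w.
by exists (\sum_j \sum_i (1 + nsq (X i j))) => _ [v /qf_unit_le + <-].
Qed.

(** The positive size makes the unit sphere nonempty, so that the supremum is a least upper
    bound. *)
Lemma unit_form_sup_le n (X : 'M[C]_n.+1) (a : R) :
  (forall w, qf 1%:M w = 1 -> qf X w <= a) -> unit_form_sup X <= a.
Proof.
move=> h; apply: ge_sup => [|_ [w w1 <-]]; last exact: h.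
have [|t _ t1] := @qf_normalize n.+1 (delta_mx 0 0); last first.
  by exists (qf X (t%:C%C *: delta_mx 0 0)); eexists; first exact: t1.
apply/eqP => /matrixP/(_ 0 0); rewrite !mxE => /eqP.
by rewrite oner_eq0.
Qed.

Variable n : nat.
Local Notation V := ('M[R]_n.+1 * 'M[R]_n.+1)%type.

(** Pairs of real matrices present the complex ones as a real vector space, on which Hahn-Banach
    yields real functionals. *)
Definition cmx (u : V) : 'M[C]_n.+1 := \matrix_(i, j) Complex (u.1 i j) (u.2 i j).

Lemma cmx0 : cmx 0 = 0.
Proof. by apply/matrixP => i j; rewrite !mxE. Qed.

Lemma cmx_lin (t : R) u v : cmx (t *: u + v) = t%:C%C *: cmx u + cmx v.
Proof.
apply/matrixP => i j; rewrite !mxE; apply/eqP.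
by rewrite eq_complex/= ?mxE !mul0r subr0 addr0 !eqxx.
Qed.

Lemma qf_cmx_lin (t : R) u v w :
  qf (cmx (t *: u + v)) w = t * qf (cmx u) w + qf (cmx v) w.
Proof. by rewrite cmx_lin qfD qfZ. Qed.

Definition pairing (g : V) (u : V) : R :=
  \sum_i \sum_j (u.1 i j * g.1 i j + u.2 i j * g.2 i j).

Lemma pairing0 g : pairing g 0 = 0.
Proof.
by rewrite /pairing big1// => i _; rewrite big1// => j _; rewrite !mxE !mul0r addr0.
Qed.

(** Values on the elementary matrices are the coefficients of a linear functional, whose graph lies
    in [G] by linearity. *)
Lemma linrel_total (G : set (V * R)) :
  (forall t u v, G u -> G v -> G (t *: u + v)) -> G 0 ->
  (forall i j, exists r, G ((delta_mx i j, 0), r)) ->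
  (forall i j, exists r, G ((0, delta_mx i j), r)) ->
  exists g : V, forall u, G (u, pairing g u).
Proof.
move=> GL G0 h1 h2.
pose g1 i j := sval (cid (h1 i j)); pose g2 i j := sval (cid (h2 i j)).
have h1' i j : G ((delta_mx i j, 0), g1 i j) by exact: (svalP (cid (h1 i j))).
have h2' i j : G ((0, delta_mx i j), g2 i j) by exact: (svalP (cid (h2 i j))).
exists (\matrix_(i, j) g1 i j, \matrix_(i, j) g2 i j) => -[P Q].
have GZ t v : G v -> G (t *: v) by move=> Gv; rewrite -[_ *: _]addr0; exact: GL.
have GD v v' : G v -> G v' -> G (v + v').
  by move=> Gv Gv'; rewrite -[v]scale1r; exact: GL.
suff -> : ((P, Q), pairing (\matrix_(i, j) g1 i j, \matrix_(i, j) g2 i j) (P, Q)) =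
    \sum_i \sum_j (P i j *: ((delta_mx i j, 0), g1 i j) +
                   Q i j *: ((0, delta_mx i j), g2 i j)) :> V * R.
  apply: (big_ind G) => // i _; apply: (big_ind G) => // j _.
  by apply: GD; apply: GZ.
pose F i j := P i j *: ((delta_mx i j, 0), g1 i j) +
                   Q i j *: ((0, delta_mx i j), g2 i j) : V * R.
have fstS I (f : I -> V * R) (r : seq I) : (\sum_(i <- r) f i).1 = \sum_(i <- r) (f i).1.
  by apply: big_morph.
have sndS I (f : I -> V * R) (r : seq I) : (\sum_(i <- r) f i).2 = \sum_(i <- r) (f i).2.
  by apply: big_morph.
have fstV I (f : I -> V) (r : seq I) : (\sum_(i <- r) f i).1 = \sum_(i <- r) (f i).1.
  by apply: big_morph.
have sndV I (f : I -> V) (r : seq I) : (\sum_(i <- r) f i).2 = \sum_(i <- r) (f i).2.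
  by apply: big_morph.
apply: injective_projections => /=; last first.
  rewrite sndS; apply: eq_bigr => i _; rewrite sndS; apply: eq_bigr => j _.
  by rewrite /= !mxE.
rewrite fstS; apply: injective_projections => /=.
  rewrite fstV [LHS]matrix_sum_delta; apply: eq_bigr => i _; rewrite fstS fstV.
  by apply: eq_bigr => j _; rewrite /= scaler0 addr0.
rewrite sndV [LHS]matrix_sum_delta; apply: eq_bigr => i _; rewrite fstS sndV.
by apply: eq_bigr => j _; rewrite /= scaler0 add0r.
Qed.

Lemma pairing_delta1 g i j : pairing g (delta_mx i j, 0) = g.1 i j.
Proof.
rewrite /pairing (bigD1 i)//= (bigD1 j)//= !mxE !eqxx/= mul1r mul0r addr0.
rewrite big1 ?addr0 => [|k kj]; last by rewrite !mxE (negPf kj) andbF !mul0r addr0.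
rewrite big1 ?addr0// => k ki; rewrite big1// => l _.
by rewrite !mxE (negPf ki) !mul0r addr0.
Qed.

Lemma pairing_delta2 g i j : pairing g (0, delta_mx i j) = g.2 i j.
Proof.
rewrite /pairing (bigD1 i)//= (bigD1 j)//= !mxE !eqxx/= mul1r mul0r add0r.
rewrite big1 ?addr0 => [|k kj]; last by rewrite !mxE (negPf kj) andbF !mul0r addr0.
rewrite big1 ?addr0// => k ki; rewrite big1// => l _.
by rewrite !mxE (negPf ki) !mul0r addr0.
Qed.

Lemma pairing_lin g t u v : pairing g (t *: u + v) = t * pairing g u + pairing g v.
Proof.
rewrite /pairing mulr_sumr -big_split; apply: eq_bigr => i _ /=.
rewrite mulr_sumr -big_split; apply: eq_bigr => j _ /=.
by rewrite !mxE; ring.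
Qed.

(* Hahn-Banach for the zero functional on [L], dominated by the largest
   eigenvalue [unit_form_sup]. *)
Lemma form_alternative (L : set V) :
  L 0 -> (forall t u v, L u -> L v -> L (t *: u + v)) ->
  (forall u, L u -> exists2 w, w != 0 & qf (cmx u) w <= 0) ->
  exists g : V, [/\ forall u, L u -> pairing g u = 0,
    forall u, (forall w, 0 <= qf (cmx u) w) -> 0 <= pairing g u &
    0 < pairing g (1%:M, 0)].
Proof.
move=> L0 LL Lnot.
pose p (u : V) := unit_form_sup (cmx u).
have pD u v : p (u + v) <= p u + p v.
  apply: unit_form_sup_le => w w1; rewrite -[u]scale1r qf_cmx_lin mul1r scale1r.
  by rewrite lerD// qf_le_sup.
have pZ t u : 0 < t -> p (t *: u) <= t * p u.
  move=> t0; apply: unit_form_sup_le => w w1.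
  rewrite -[_ *: _]addr0 cmx_lin qfD qfZ.
  by rewrite cmx0 qf0 addr0 ler_pM2l// qf_le_sup.
have h0 : dominated_linrel p [set u : V * R | L u.1 /\ u.2 = 0].
  split => //= [t u v [Lu u0] [Lv v0]|[u r] /= [Lu ->]].
    split; first exact: LL.
    by rewrite u0 v0 scaler0 addr0.
  (* Applied to [- u], the hypothesis on [L] gives a vector at which the form of [u] is nonnegative;
     hence [0 <= p u]. *)
  have /Lnot[w w0] : L (- 1 *: u + 0) by exact: LL.
  have [t t0 t1] := qf_normalize w0.
  rewrite cmx_lin qfD qfZ.
  rewrite cmx0 qf0 addr0 mulN1r oppr_le0 => w_ge0.
  apply: le_trans (qf_le_sup _ t1).
  by rewrite qf_scale mulr_ge0// sqr_ge0.
pose s : seq V := [seq (delta_mx ij.1 ij.2, 0) | ij : 'I_n.+1 * 'I_n.+1] ++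
                  [seq (0, delta_mx ij.1 ij.2) | ij : 'I_n.+1 * 'I_n.+1].
have [G [[G0 GL Gp] GG Gs]] := linrel_extend pD pZ s h0.
have [||g hg] := @linrel_total G GL G0.
- by move=> i j; apply: Gs; rewrite mem_cat; apply/orP; left;
  apply/mapP; exists (i, j); rewrite ?mem_enum.
- by move=> i j; apply: Gs; rewrite mem_cat; apply/orP; right;
  apply/mapP; exists (i, j); rewrite ?mem_enum.
exists g; split.
(* [G] contains both [(u, 0)] and [(u, pairing g u)]. Their two differences lie over 0, where [p] is
   at most 0, so the values agree. *)
- move=> u Lu.
  have Gu0 : G (u, 0) by apply: GG.
  have eqN : (0, - pairing g u) = -1 *: (u, pairing g u) + (u, 0) :> V * R.
    by rewrite scaleN1r; congr pair; rewrite /= ?addNr ?addr0.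
  have eqP' : (0, pairing g u) = -1 *: (u, 0) + (u, pairing g u) :> V * R.
    by rewrite scaleN1r; congr pair; rewrite /= ?addNr ?oppr0 ?add0r.
  have p0 : p 0 <= 0.
    apply: unit_form_sup_le => w _.
    by rewrite cmx0 qf0.
  have /Gp/= h1 : G (0, - pairing g u) by rewrite eqN; exact: GL.
  have /Gp/= h2 : G (0, pairing g u) by rewrite eqP'; exact: GL.
  apply/eqP; rewrite eq_le (le_trans h2 p0)/= -oppr_le0.
  exact: le_trans h1 p0.
(* If the form of [u] is nonnegative then [p (- u) <= 0]; for the identity, [p (- 1) <= - 1] gives
   strict positivity in the next item. *)
- move=> u u_ge0; rewrite -oppr_le0.
  have := Gp _ (hg (-1 *: u + 0)); rewrite /= pairing_lin.
  rewrite pairing0 mulN1r addr0 => /le_trans; apply.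
  apply: unit_form_sup_le => w w1; rewrite cmx_lin qfD qfZ.
  by rewrite cmx0 qf0 addr0 mulN1r oppr_le0.
- rewrite -oppr_lt0.
  have := Gp _ (hg (-1 *: (1%:M, 0) + 0)); rewrite /= pairing_lin.
  rewrite pairing0 mulN1r addr0 => /le_lt_trans; apply.
  apply: (@le_lt_trans _ _ (-1)); last by rewrite ltrN10.
  apply: unit_form_sup_le => w w1; rewrite cmx_lin qfD qfZ.
  have -> : cmx (1%:M, 0) = 1%:M.
    apply/matrixP => i j; rewrite !mxE; case: (i == j) => //.
  by rewrite cmx0 qf0 addr0 mulN1r w1.
Qed.
End FormDuality.

(** * Definiteness over both fields and the trace pairing *)

Section Definiteness.
Variables (R : realType) (K : base_field).
Local Notation F := (scalarF R K).
Local Notation C := R[i].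

Lemma cplF_inj : injective (@cplF R K).
Proof. exact: fmorph_inj. Qed.

Lemma cplmx_inj m n : injective (@cplmx R K m n).
Proof.
move=> A B /matrixP h; apply/matrixP => i j; apply: cplF_inj.
by have := h i j; rewrite !mxE.
Qed.

Lemma cplmxM m n p (A : 'M[F]_(m, n)) (B : 'M[F]_(n, p)) :
  cplmx (A *m B) = cplmx A *m cplmx B.
Proof. exact: map_mxM. Qed.

Lemma cplmx0 m n : cplmx (0 : 'M[F]_(m, n)) = 0.
Proof. exact: map_mx0. Qed.

Lemma cplmx_eq0 m n (A : 'M[F]_(m, n)) : (cplmx A == 0) = (A == 0).
Proof. by rewrite -(cplmx0 m n) (inj_eq (@cplmx_inj m n)). Qed.

Lemma realF_ge0 (t : R) : (0 <= realF K t) = (0 <= t).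
Proof. by case: K => //=; rewrite -[RHS]ler0c. Qed.

Lemma realF_gt0 (t : R) : (0 < realF K t) = (0 < t).
Proof. by case: K => //=; rewrite /realF/= ltcR. Qed.

Lemma qf_herm_real n (X : 'M[C]_n) w : hadj X = X ->
  (w *m X *m hadj w) 0 0 = (qf X w)%:C%C.
Proof.
move=> hX; have : hadj (w *m X *m hadj w) = w *m X *m hadj w.
  by rewrite !hadjM hadjK hX mulmxA.
move=> /matrixP/(_ 0 0); rewrite /qf 2!mxE; set z := (_ *m _) 0 0 => zE.
apply/esym/RRe_real; apply/CrealP; exact: zE.
Qed.

Lemma hadj1 n : hadj (1%:M : 'M[C]_n) = 1%:M.
Proof. exact: (hadj_scalar n 1). Qed.

(** An eigenvalue is the Rayleigh quotient of its eigenvector. *)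
Lemma eigenvalue_qf n (X : 'M[F]_n) (v : 'rV[F]_n) a : SymF X -> v != 0 ->
  v *m X = a *: v ->
  a = realF K (qf (cplmx X) (cplmx v) / qf 1%:M (cplmx v)).
Proof.
move=> hX v0 va; apply: cplF_inj; rewrite cplF_realF.
have c0 : cplmx v != 0 by rewrite cplmx_eq0.
have /= h1 := qf_herm_real (cplmx v) (cplmx_herm hX).
have /= h2 := qf_herm_real (cplmx v) (hadj1 n).
rewrite mulmx1 in h2.
have e : cplmx v *m cplmx X = cplF a *: cplmx v by rewrite -cplmxM va /cplmx map_mxZ.
rewrite e -scalemxAl mxE h2 in h1.
rewrite rmorphM fmorphV /= -h1 mulfK//=.
rewrite -[0 : C]/((0 : R)%:C%C) (inj_eq (@complexI R)).
by rewrite gt_eqF// qf1_gt0.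
Qed.

Lemma eigenvalue_spectral n (X : 'M[F]_n) (P : 'M[C]_n) (d : 'rV[R]_n) i :
  hadj P *m P = 1%:M ->
  cplmx X = hadj P *m diag_mx (map_mx (real_complex R) d) *m P ->
  eigenvalue X (realF K (d 0 i)).
Proof.
move=> PP eX; rewrite eigenvalue_root_char.
rewrite -(fmorph_root (@cplF R K)) map_char_poly/= -/(cplmx X) eX char_poly_diag//.
rewrite cplF_realF /root horner_prod prodf_seq_eq0; apply/hasP.
by exists i; rewrite ?mem_index_enum// mxE hornerXsubC subrr eqxx.
Qed.

Lemma qf_spectral0 n (P : 'M[C]_n) (d : 'rV[R]_n) w : hadj P *m P = 1%:M ->
  P *m hadj P = 1%:M ->
  qf (hadj P *m diag_mx (map_mx (real_complex R) d) *m P) w =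
    \sum_i d 0 i * nsq ((w *m hadj P) 0 i).
Proof.
move=> PP PP'; rewrite -[w in LHS]mulmx1 -PP mulmxA.
have := qf_spectral d 0 (w *m hadj P) PP'.
have -> : ((0 : R)%:C%C)%:M = 0 :> 'M[C]_n by exact: raddf0.
rewrite subr0 => ->.
by apply: eq_bigr => i _; rewrite subr0.
Qed.

(** Expansion in an eigenbasis in one direction, Rayleigh quotients in the other. The test vectors
    are complex even when [X] is real. *)
Lemma posdefP n (X : 'M[F]_n) : SymF X ->
  posdef X <-> forall w, w != 0 -> 0 < qf (cplmx X) w.
Proof.
move=> hX; split=> [[_ Xpos] w w0|h]; last first.
  split=> // a /eigenvalueP[v va v0].
  have c0 : cplmx v != 0 by rewrite cplmx_eq0.
  rewrite (eigenvalue_qf hX v0 va) realF_gt0.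
  by rewrite divr_gt0 ?h ?qf1_gt0.
have [P [d [PP' PP eX]]] := herm_spectral (cplmx_herm hX).
rewrite eX qf_spectral0//.
have d0 i : 0 < d 0 i.
  by rewrite -realF_gt0; apply: Xpos; exact: eigenvalue_spectral PP eX.
have : w *m hadj P != 0.
  by apply: contra w0 => /eqP e; rewrite -[w]mulmx1 -PP mulmxA e mul0mx.
move=> /rV0Pn[i wi]; rewrite (bigD1 i)//= ltr_pwDl//.
  by rewrite mulr_gt0// lt_def nsq_ge0 nsq_eq0 wi.
by apply: sumr_ge0 => j _; rewrite mulr_ge0 ?nsq_ge0// ltW.
Qed.

Lemma SymF_plus_intro n (X : 'M[F]_n) : SymF X ->
  (forall v : 'rV[F]_n, 0 <= qf (cplmx X) (cplmx v)) -> SymF_plus X.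
Proof.
move=> hX h; split=> // a /eigenvalueP[v va v0].
by rewrite (eigenvalue_qf hX v0 va) realF_ge0 divr_ge0 ?h ?qf1_ge0.
Qed.

(** In an eigenbasis of [Y] the trace is the sum of [d 0 i * qf (cplmx X) (row i P)], with
    [0 <= d 0 i] and positive second factors; if it is zero, so is [d]. *)
Lemma posdef_trace_eq0 n (X Y : 'M[F]_n) : posdef X -> SymF_plus Y ->
  \tr (X *m Y) = 0 -> Y = 0.
Proof.
move=> Xpos [hY Ypos] trXY.
have [P [d [PP' PP eY]]] := herm_spectral (cplmx_herm hY).
have d0 i : 0 <= d 0 i.
  by rewrite -realF_ge0; apply: Ypos; exact: eigenvalue_spectral PP eY.
have hX := Xpos.1; have /(posdefP hX) Xq := Xpos.
have : complex.Re (\tr (cplmx X *m cplmx Y)) = 0.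
  by rewrite -cplmxM /cplmx trace_map_mx trXY rmorph0.
have Pi0 i : row i P != 0.
  apply/eqP => /(congr1 (mulmx^~ (hadj P))); rewrite mul0mx -row_mul PP'.
  by move=> /rowP/(_ i); rewrite !mxE eqxx => /eqP; rewrite oner_eq0.
have -> : complex.Re (\tr (cplmx X *m cplmx Y)) =
    \sum_i d 0 i * qf (cplmx X) (row i P).
  rewrite eY mulmxA mxtrace_mulC !mulmxA /mxtrace Re_sum; apply: eq_bigr => i _.
  rewrite mul_mx_diag mxE mulrC mxE ReZ; congr (_ * complex.Re _).
  rewrite !mxE; apply: eq_bigr => j _; rewrite !mxE; congr (_ * _).
  by apply: eq_bigr => l _; rewrite !mxE.
move=> /eqP; rewrite psumr_eq0 => [/allP h|i _]; last first.
  by rewrite mulr_ge0// ltW// Xq.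
apply: cplmx_inj; rewrite eY cplmx0.
suff -> : d = 0 by rewrite map_mx0 raddf0 mulmx0 mul0mx.
apply/rowP => i; rewrite mxE; have := h i (mem_index_enum _) => /=.
by rewrite mulf_eq0 (gt_eqF (Xq _ (Pi0 i))) orbF => /eqP.
Qed.

Lemma reFM (a b : F) : @reF R K (a * b) = reF a * reF b - imF a * imF b.
Proof.
by case: K a b => [a b|[? ?] [? ?]] //=; rewrite mul0r subr0.
Qed.

Lemma reF_sum (I : Type) (r : seq I) (f : I -> F) :
  @reF R K (\sum_(i <- r) f i) = \sum_(i <- r) reF (f i).
Proof.
apply: big_morph; last by case: K.
by case: K => //= [[? ?] [? ?]].
Qed.

Lemma mkF_eta (a : F) : mkF K (reF a) (imF a) = a.
Proof. by case: K a => // -[]. Qed.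

Lemma reF_mkF (a b : R) : @reF R K (mkF K a b) = a.
Proof. by case: K. Qed.

Lemma reF_conj (a : F) : reF (conjF a) = reF a.
Proof. by case: K a => // -[]. Qed.

Lemma imF_conj (a : F) : imF (conjF a) = - imF a.
Proof. by case: K a => [a|[]]//=; rewrite oppr0. Qed.

Lemma reF0 : @reF R K 0 = 0. Proof. by case: K. Qed.
Lemma imF0 : @imF R K 0 = 0. Proof. by case: K. Qed.

Lemma eqF (a b : F) : reF a = reF b -> imF a = imF b -> a = b.
Proof. by move=> h1 h2; rewrite -[a]mkF_eta -[b]mkF_eta h1 h2. Qed.

Lemma reF_lin t (a b : F) : @reF R K (realF K t * a + b) = t * reF a + reF b.
Proof. by case: K a b => [|[? ?] [? ?]]//=; rewrite mul0r subr0. Qed.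

Lemma imF_lin t (a b : F) : @imF R K (realF K t * a + b) = t * imF a + imF b.
Proof.
case: K a b => [|[? ?] [? ?]]//=; first by rewrite mulr0 addr0.
by rewrite mul0r addr0.
Qed.

(** Taking the adjoint of the product exchanges its Hermitian factors, which leaves the trace
    unchanged: it equals its own conjugate. *)
Lemma imF_tr n (X Y : 'M[F]_n) : SymF X -> SymF Y -> @imF R K (\tr (X *m Y)) = 0.
Proof.
move=> hX hY; suff : @imF R K (\tr (X *m Y)) = - @imF R K (\tr (X *m Y)).
  by move=> /eqP; rewrite -addr_eq0 -mulr2n mulrn_eq0 => /eqP.
rewrite -imF_conj; congr (@imF R K _); apply: cplF_inj; rewrite cplF_conjF.
rewrite -trace_map_mx -/(cplmx _) cplmxM.
have -> : (\tr (cplmx X *m cplmx Y))^* = \tr (hadj (cplmx X *m cplmx Y)).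
  by rewrite /hadj trace_map_mx mxtrace_tr.
by rewrite hadjM !cplmx_herm// mxtrace_mulC.
Qed.

Definition reim_mx n (X : 'M[F]_n) : 'M[R]_n * 'M[R]_n :=
  (map_mx (@reF R K) X, map_mx (@imF R K) X).

Lemma cmx_reim n (X : 'M[F]_n.+1) : cmx (reim_mx X) = cplmx X.
Proof. by apply/matrixP => i j; rewrite !mxE. Qed.

Lemma reim_lin n t (X Y : 'M[F]_n) :
  reim_mx (realF K t *: X + Y) = t *: reim_mx X + reim_mx Y.
Proof.
congr pair; apply/matrixP => i j; rewrite !mxE; [exact: reF_lin|exact: imF_lin].
Qed.

(** The conditions on [g] say that [g.1 + i g.2] is Hermitian; the antisymmetry of [g.2] absorbs the
    sign of [i^2] in the real part of the trace. *)
Lemma pairing_reim n (g : 'M[R]_n.+1 * 'M[R]_n.+1) (X : 'M[F]_n.+1) :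
  g.1^T = g.1 -> g.2^T = - g.2 ->
  pairing g (reim_mx X) =
    @reF R K (\tr (X *m (\matrix_(i, j) mkF K (g.1 i j) (g.2 i j)))).
Proof.
move=> s1 s2; rewrite /pairing /mxtrace reF_sum; apply: eq_bigr => i _.
rewrite !mxE reF_sum; apply: eq_bigr => j _.
rewrite !mxE reFM reF_mkF.
have -> : g.1 j i = g.1 i j by rewrite -[in RHS]s1 mxE.
have -> : g.2 i j = - g.2 j i by have /matrixP/(_ j i) := s2; rewrite !mxE.
by case: K X => X //=; rewrite ?mul0r ?subr0 ?addr0 ?mulrN.
Qed.

Lemma posdef_alternative n (L : set 'M[F]_n.+1) : L `<=` @SymF R K n.+1 -> L 0 ->
  (forall t X Y, L X -> L Y -> L (realF K t *: X + Y)) ->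
  (exists X, L X /\ posdef X) <->
  frobenius_orth L `&` @SymF_plus R K n.+1 = [set 0].
Proof.
move=> LS L0 LL; split=> [[X [LX Xpos]]|orth0].
  apply/seteqP; split=> [Y [[_ YL] Ypos]|_ ->] /=.
    exact: posdef_trace_eq0 Xpos Ypos (YL _ LX).
  have h0 : SymF (0 : 'M[F]_n.+1).
    by apply: cplmx_inj; rewrite cplmx_adjoint cplmx0 /hadj trmx0 map_mx0.
  split; first by split=> // Y _; rewrite mulmx0 mxtrace0.
  by apply: SymF_plus_intro => // v; rewrite cplmx0 qf0.
apply: contrapT => nL.
have [||u [X LX <-]|g [gL gpos g1]] :=
    @form_alternative R n (@reim_mx n.+1 @` L).
- exists 0 => //; congr pair; apply/matrixP => i j; rewrite !mxE; [exact: reF0|exact: imF0].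
- move=> t _ _ [X LX <-] [Y LY <-]; exists (realF K t *: X + Y); first exact: LL.
  exact: reim_lin.
- apply: contrapT => nX; apply: nL; exists X; split=> //.
  apply/posdefP; first exact: LS.
  move=> w w0; rewrite ltNge; apply/negP => h; apply: nX; exists w => //.
  by rewrite cmx_reim.
(* A form that vanishes identically is nonnegative together with its opposite. Applied below to
   anti-Hermitian combinations of two elementary matrices, where the real part of the form vanishes,
   this makes [g] Hermitian. *)
have anti (u : 'M[R]_n.+1 * 'M[R]_n.+1) : (forall w, qf (cmx u) w = 0) -> pairing g u = 0.
  move=> hu; apply/eqP; rewrite eq_le gpos ?andbT => [|w]; last by rewrite hu.
  suff: 0 <= -1 * pairing g u + pairing g 0 by rewrite pairing0 addr0 mulN1r oppr_ge0.
  rewrite -pairing_lin; apply: gpos => w.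
  by rewrite qf_cmx_lin hu cmx0 qf0 mulr0 addr0.
have qf_hadj (Z : 'M[C]_n.+1) w : qf (hadj Z) w = qf Z w.
  have e : w *m hadj Z *m hadj w = hadj (w *m Z *m hadj w).
    by rewrite !hadjM hadjK mulmxA.
  by rewrite /qf e 2!mxE; case: ((_ *m _) 0 0).
have s1 : g.1^T = g.1.
  apply/matrixP => i j; rewrite mxE; apply/eqP; rewrite -subr_eq0; apply/eqP.
  rewrite -!pairing_delta1 addrC -mulN1r -pairing_lin; apply: anti => w.
  rewrite qf_cmx_lin mulN1r -qf_hadj addrC; apply/eqP; rewrite subr_eq0; apply/eqP.
  congr qf; apply/matrixP => k l; rewrite !mxE andbC; apply/eqP.
  by rewrite eq_complex/= ?oppr0 !eqxx.
have s2 : g.2^T = - g.2.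
  apply/matrixP => i j; rewrite !mxE; apply/eqP; rewrite -addr_eq0; apply/eqP.
  rewrite -!pairing_delta2 -[pairing g _]mul1r -pairing_lin; apply: anti => w.
  rewrite qf_cmx_lin mul1r -qf_hadj -qfD.
  have -> : hadj (cmx (0, delta_mx j i)) + cmx (0, delta_mx i j) = 0 :> 'M[C]_n.+1.
    apply/matrixP => k l; rewrite !mxE andbC; apply/eqP.
    by rewrite eq_complex/= addr0 addNr !eqxx.
  exact: qf0.
set Y : 'M[F]_n.+1 := \matrix_(i, j) mkF K (g.1 i j) (g.2 i j).
have hY : SymF Y.
  rewrite /SymF/=; apply/matrixP => i j; rewrite !mxE.
  have -> : g.1 j i = g.1 i j by rewrite -[in RHS]s1 mxE.
  have -> : g.2 j i = - g.2 i j by have /matrixP/(_ i j) := s2; rewrite !mxE.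
  by case: K => //=; rewrite opprK.
have /seteqP[/(_ Y) Y0 _] := orth0.
have : Y = 0.
  apply: Y0; split.
    split=> // X LX; apply: eqF; rewrite ?reF0 ?imF0.
      by rewrite -pairing_reim// gL//; exists X.
    by apply: imF_tr => //; exact: LS.
  (* The form of [Y] at [v] is the pairing of [g] with the positive semidefinite matrix
     [adjoint v *m v]. *)
  apply: SymF_plus_intro => // v.
  have -> : qf (cplmx Y) (cplmx v) = @reF R K (\tr (adjoint v *m v *m Y)).
    rewrite -mulmxA mxtrace_mulC /mxtrace big_ord1 /qf -cplmx_adjoint -!cplmxM.
    by rewrite mxE.
  rewrite -pairing_reim//; apply: gpos => w.
  rewrite cmx_reim cplmxM cplmx_adjoint.
  have := qf_mulmx 1%:M (hadj (cplmx v)) w; rewrite mulmx1 hadjK => ->.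
  exact: qf1_ge0.
(* The pairing of [g] with the identity is the real part of the trace of [Y]: it would be both
   positive and zero. *)
move=> Yeq0; move: g1.
have -> : (1%:M, 0) = reim_mx (1%:M : 'M[F]_n.+1).
  congr pair; apply/matrixP => i j; rewrite !mxE; case: K (i == j) => -[] //=.
by rewrite pairing_reim// -/Y Yeq0 mulmx0 mxtrace0 reF0 ltxx.
Qed.
End Definiteness.

(** * Perturbation of eigenvalues *)

Section MatrixNorm.
Variable R : realType.
Local Notation C := R[i].

Definition absc (z : C) : R := `|complex.Re z| + `|complex.Im z|.

Lemma absc_ge0 z : 0 <= absc z.
Proof. by rewrite addr_ge0. Qed.

Lemma abscD x y : absc (x + y) <= absc x + absc y.
Proof.
case: x y => [a b] [c d]; rewrite /absc/= addrACA.
by rewrite lerD// ler_normD.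
Qed.

Lemma abscM x y : absc (x * y) <= absc x * absc y.
Proof.
case: x y => [a b] [c d]; rewrite /absc/= mulrDl !mulrDr -!normrM.
have := ler_normB (a * c) (b * d); have := ler_normD (a * d) (b * c); lra.
Qed.

(** An entrywise [l1] norm: submultiplicative, and a bound for the quadratic form. *)
Definition absmx n (X : 'M[C]_n) : R := \sum_i \sum_j absc (X i j).

Lemma absmx_ge0 n (X : 'M[C]_n) : 0 <= absmx X.
Proof. by apply: sumr_ge0 => i _; apply: sumr_ge0 => j _; exact: absc_ge0. Qed.

Lemma absmxD n (X Y : 'M[C]_n) : absmx (X + Y) <= absmx X + absmx Y.
Proof.
rewrite -big_split; apply: ler_sum => i _; rewrite -big_split.
by apply: ler_sum => j _; rewrite mxE abscD.
Qed.

Lemma absmxN n (X : 'M[C]_n) : absmx (- X) = absmx X.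
Proof.
apply: eq_bigr => i _; apply: eq_bigr => j _; rewrite mxE.
by case: (X i j) => a b; rewrite /absc/= !normrN.
Qed.

Lemma absmxZ n (t : R) (X : 'M[C]_n) : absmx (t%:C%C *: X) = `|t| * absmx X.
Proof.
rewrite mulr_sumr; apply: eq_bigr => i _; rewrite mulr_sumr; apply: eq_bigr => j _.
rewrite mxE; case: (X i j) => a b; rewrite /absc/= !mul0r subr0 addr0 !normrM.
by rewrite mulrDr.
Qed.

Lemma absc_sum (I : finType) (f : I -> C) : absc (\sum_i f i) <= \sum_i absc (f i).
Proof.
elim/big_rec2: _ => [|i y z _ h]; first by rewrite /absc/= !normr0 addr0.
by apply: le_trans (abscD _ _) _; rewrite lerD2l.
Qed.

Lemma absmxM n (X Y : 'M[C]_n) : absmx (X *m Y) <= absmx X * absmx Y.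
Proof.
apply: (@le_trans _ _ (\sum_i \sum_j \sum_k absc (X i k) * absc (Y k j))).
  apply: ler_sum => i _; apply: ler_sum => j _; rewrite mxE.
  by apply: le_trans (absc_sum _) _; apply: ler_sum => k _; exact: abscM.
rewrite mulr_suml; apply: ler_sum => i _.
rewrite exchange_big mulr_suml; apply: ler_sum => k _.
rewrite -mulr_sumr ler_wpM2l ?absc_ge0//.
rewrite [leRHS](bigD1 k)//= lerDl; apply: sumr_ge0 => l _.
by apply: sumr_ge0 => j _; exact: absc_ge0.
Qed.

Lemma absmx_scalar n (t : R) : absmx ((t%:C%C)%:M : 'M[C]_n) = n%:R * `|t|.
Proof.
rewrite /absmx (eq_bigr (fun=> `|t|)); last first.
  move=> i _; rewrite (bigD1 i)//= big1 ?addr0 => [|j ji].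
    by rewrite mxE eqxx /absc/= normr0 addr0.
  by rewrite mxE eq_sym (negPf ji) /absc/= normr0 addr0.
by rewrite sumr_const card_ord mulr_natl.
Qed.

Lemma scalar_mxB n (a b : R) :
  ((a - b)%:C%C)%:M = (a%:C%C)%:M - (b%:C%C)%:M :> 'M[C]_n.
Proof. by rewrite rmorphB; exact: raddfB. Qed.

Lemma qf_le_absmx n (X : 'M[C]_n) w : qf X w <= absmx X * qf 1%:M w.
Proof.
rewrite qfE exchange_big mulr_suml; apply: ler_sum => i _.
rewrite mulr_suml; apply: ler_sum => j _.
have nle k : nsq (w 0 k) <= qf 1%:M w.
  by rewrite qf1 (bigD1 k)//= lerDl sumr_ge0// => *; exact: nsq_ge0.
have := nle i; have := nle j; set q := qf _ _.
rewrite /nsq /absc; case: (X i j) (w 0 i) (w 0 j) => [a b] [x y] [z t] /=.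
(* The real and imaginary parts of [w_i] times the conjugate of [w_j]; both are at most [q] in
   absolute value since [2 |p r| <= p^2 + r^2], which the squares below encode. *)
set u := x * z + y * t; set v := y * z - x * t => h1 h2.
have -> : (x * a - y * b) * z - (x * b + y * a) * - t = a * u - b * v.
  by rewrite /u /v; ring.
have s1 := sqr_ge0 (x - z); have s2 := sqr_ge0 (x + z).
have s3 := sqr_ge0 (y - t); have s4 := sqr_ge0 (y + t).
have s5 := sqr_ge0 (y - z); have s6 := sqr_ge0 (y + z).
have s7 := sqr_ge0 (x - t); have s8 := sqr_ge0 (x + t).
have uq : `|u| <= q by rewrite ler_norml /u; apply/andP; split; lra.
have vq : `|v| <= q by rewrite ler_norml /v; apply/andP; split; lra.
apply: le_trans (ler_norm _) _; apply: le_trans (ler_normB _ _) _.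
by rewrite !normrM mulrDl lerD// ler_wpM2l.
Qed.

Lemma qf_ge_absmx n (X : 'M[C]_n) w : - (absmx X * qf 1%:M w) <= qf X w.
Proof.
rewrite lerNl -(absmxN X); apply: le_trans (qf_le_absmx _ _).
by rewrite -[- X]add0r qfB qf0 sub0r.
Qed.

Lemma subrBB (V : zmodType) (x y z t : V) : x - y - (z - t) = (x - z) + (t - y).
Proof. by rewrite opprB [t - z]addrC addrACA [- y + t]addrC. Qed.

(** Weyl's perturbation inequality. If it failed, [lambda_hat_lt] with [G = 1] and [mu'] the [k]-th
    eigenvalue of [A'] would put that eigenvalue strictly above itself. *)
Lemma lambda_hat_lip1 K n (A A' : 'M[scalarF R K]_n) (k : 'I_n) :
  SymF A -> SymF A' ->
  lambda_hat A k - absmx (cplmx A' - cplmx A) <= lambda_hat A' k.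
Proof.
move=> sA sA'; rewrite leNgt; apply/negP => h.
set D := cplmx A' - cplmx A in h.
have : lambda_hat A k - (lambda_hat A k - lambda_hat A' k) < lambda_hat A' k.
  apply: (@lambda_hat_lt _ _ _ _ _ 1%:M (lambda_hat A k) _ k sA sA') => // w w0.
  rewrite subKr mulmx1 -subr_gt0 -qfB.
  have -> : cplmx A' - ((lambda_hat A' k)%:C%C)%:M - (cplmx A - ((lambda_hat A k)%:C%C)%:M)
      = D + ((lambda_hat A k - lambda_hat A' k)%:C%C)%:M.
    by rewrite scalar_mxB /D subrBB.
  rewrite qfD qf_scalar; have hD := qf_ge_absmx D w.
  have : 0 < (lambda_hat A k - absmx D - lambda_hat A' k) * qf 1%:M w.
    by rewrite mulr_gt0 ?qf1_gt0// subr_gt0.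
  move: (lambda_hat A k) (lambda_hat A' k) (absmx D) (qf 1%:M w) (qf D w) hD.
  by clear; move=> a b N q x; lra.
by rewrite subKr ltxx.
Qed.

Lemma lambda_hat_lip K n (A A' : 'M[scalarF R K]_n) (k : 'I_n) :
  SymF A -> SymF A' ->
  `|lambda_hat A' k - lambda_hat A k| <= absmx (cplmx A' - cplmx A).
Proof.
move=> sA sA'; have h1 := lambda_hat_lip1 k sA sA'; have h2 := lambda_hat_lip1 k sA' sA.
have e : absmx (cplmx A - cplmx A') = absmx (cplmx A' - cplmx A).
  by rewrite -absmxN opprB.
rewrite e in h2; rewrite ler_norml.
move: (absmx _) (lambda_hat A k) (lambda_hat A' k) h1 h2; clear => N a b h1 h2.
by apply/andP; split; lra.
Qed.
End MatrixNorm.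

(** * Finsler's lemma by compactness of the unit sphere *)

Section Finsler.
Variables (R : realType) (n : nat).
Local Notation C := R[i].

Definition cvec (z : 'rV[R]_(n + n)) : 'rV[C]_n :=
  \row_i Complex (z 0 (lshift n i)) (z 0 (rshift n i)).

Lemma cvec_surj w : exists z, cvec z = w.
Proof.
exists (row_mx (map_mx (@complex.Re R) w) (map_mx (@complex.Im R) w)).
by apply/rowP => i; rewrite mxE row_mxEl row_mxEr !mxE; case: (w 0 i).
Qed.

Lemma continuous_bigsum (T : topologicalType) (I : finType) (f : I -> T -> R) :
  (forall i, continuous (f i)) -> continuous (fun z => \sum_i f i z).
Proof.
move=> cf z; elim: (index_enum I) => [|i s IH].
  by under eq_fun do rewrite big_nil; rewrite ?big_nil; exact: cvg_cst.
under eq_fun do rewrite big_cons.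
by rewrite ?big_cons; exact: (cvgD (cf i z) IH).
Qed.

Lemma qf_cvec_continuous (X : 'M[C]_n) : continuous (fun z => qf X (cvec z)).
Proof.
under eq_fun do rewrite qfE.
apply: continuous_bigsum => j; apply: continuous_bigsum => i z.
have c0 k : (fun y : 'rV[R]_(n + n) => y 0 k) @ z --> z 0 k by exact: coord_continuous.
case: (X i j) => a b.
have e : (fun y => complex.Re (cvec y 0 i * Complex a b * (cvec y 0 j)^*)) =
    (fun y => (y 0 (lshift n i) * a - y 0 (rshift n i) * b) * y 0 (lshift n j) -
              (y 0 (lshift n i) * b + y 0 (rshift n i) * a) * - y 0 (rshift n j)).
  by apply/funext => y; rewrite !mxE.
rewrite e; exact: (cvgB (cvgM (cvgB (cvgM (c0 (lshift n i)) (cvg_cst a))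
    (cvgM (c0 (rshift n i)) (cvg_cst b))) (c0 (lshift n j)))
  (cvgM (cvgD (cvgM (c0 (lshift n i)) (cvg_cst b))
    (cvgM (c0 (rshift n i)) (cvg_cst a))) (cvgN (c0 (rshift n j))))).
Qed.

Lemma unit_sphere_compact : compact [set z | qf 1%:M (cvec z) = 1].
Proof.
apply: bounded_closed_compact; last first.
  apply: (@preimage_closed _ _ (fun z => qf 1%:M (cvec z)) [set 1]).
    by move=> z _; exact: qf_cvec_continuous.
  exact: closed_eq.
exists 1; split; first exact: num_real.
move=> M M1 z /= z1; rewrite [leLHS]/Num.norm/= mx_normrE; apply: bigmax_le.
  by rewrite ltW// (lt_trans ltr01).
move=> [i j] _ /=; rewrite ord1; apply: le_trans (ltW M1).
have nle k : nsq (cvec z 0 k) <= 1.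
  by rewrite -z1 qf1 (bigD1 k)//= lerDl sumr_ge0// => *; exact: nsq_ge0.
case: (splitP j) => k jk.
  have -> : j = lshift n k by apply: val_inj.
  have := nle k; rewrite mxE /nsq/= => h; rewrite ler_norml; apply/andP; split; nra.
have -> : j = rshift n k by apply: val_inj.
have := nle k; rewrite mxE /nsq/= => h; rewrite ler_norml; apply/andP; split; nra.
Qed.

(** The form of [A *m A] at [w] is the squared norm of [w *m A]. Near a unit vector killed by [A]
    the form of [D] is positive; near any other, a large multiple of [A *m A] dominates. Compactness
    makes the multiple uniform. *)
Lemma finsler (D A : 'M[C]_n) : hadj A = A ->
  (forall w, w != 0 -> w *m A = 0 -> 0 < qf D w) ->
  exists (tau c : R), 0 < c /\
    forall w, c * qf 1%:M w <= qf (D + tau%:C%C *: (A *m A)) w.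
Proof.
move=> hA hD.
have qAA w : qf (A *m A) w = qf 1%:M (w *m A).
  by rewrite -qf_mulmx mulmx1 hA.
pose S := [set z | qf 1%:M (cvec z) = 1].
have [N hN] : exists N : nat, forall z, S z ->
    N.+1%:R^-1 <= qf D (cvec z) + N%:R * qf (A *m A) (cvec z).
  (* One integer gives both constants, [tau = N] and [c = 1 / (N + 1)], so a single covering
     argument along [\oo] suffices. *)
  have /compact_near_coveringP/(_ nat \oo (fun N z =>
    N.+1%:R^-1 <= qf D (cvec z) + N%:R * qf (A *m A) (cvec z))) := unit_sphere_compact.
  move=> /(_ _)[|N _ /(_ N (leqnn _)) hN]; last by exists N => z; exact: hN.
  move=> z Sz; have cD := @qf_cvec_continuous D z; have cA := @qf_cvec_continuous (A *m A) z.
  have [Az|Az] := eqVneq (cvec z *m A) 0.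
    have z0 : cvec z != 0.
      by apply/eqP => e; move: Sz; rewrite /S/= e qf1 big1 => [/eqP|i _];
        rewrite ?(eq_sym 0) ?oner_eq0// mxE /nsq/= expr0n addr0.
    have D0 := hD _ z0 Az; set a := qf D (cvec z) in D0.
    have h1 : \forall y \near nbhs z, a / 2 < qf D (cvec y).
      by apply: (cvgr_gt _ cD); rewrite -/a; lra.
    have h2 : \forall N \near \oo, N.+1%:R^-1 < a / 2.
      by apply: near_infty_natSinv_lt (PosNum (divr_gt0 D0 _)).
    exists ([set y | a / 2 < qf D (cvec y)], [set N : nat | N.+1%:R^-1 < a / 2]) => //.
    move=> [y N] [/= h3 h4]; rewrite qAA.
    by rewrite (le_trans (ltW (lt_trans h4 h3)))// lerDl mulr_ge0// qf1_ge0.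
  have A0 : 0 < qf (A *m A) (cvec z) by rewrite qAA qf1_gt0.
  set a := qf (A *m A) (cvec z) in A0; set b := qf D (cvec z).
  have h1 : \forall y \near nbhs z, b - 1 < qf D (cvec y).
    by apply: (cvgr_gt _ cD); rewrite -/b; lra.
  have h2 : \forall y \near nbhs z, a / 2 < qf (A *m A) (cvec y).
    by apply: (cvgr_gt _ cA); rewrite -/a; lra.
  (* With this [N] the lower bounds [b - 1] and [2 - b] of the two terms add up to 1. *)
  have h3 : \forall N \near \oo, (2 - b) / (a / 2) <= N%:R by exact: nbhs_infty_ger.
  exists ([set y | b - 1 < qf D (cvec y) /\ a / 2 < qf (A *m A) (cvec y)],
          [set N : nat | (2 - b) / (a / 2) <= N%:R]).
    by split => //=; apply: filterI.
  move=> [y N] [/= [h4 h5] h6].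
  have a2 : 0 < a / 2 by rewrite divr_gt0.
  rewrite ler_pdivrMr// in h6.
  have h7 : N.+1%:R^-1 <= 1 :> R by rewrite invf_le1 ?ltr0n// ler1n.
  have h8 : N%:R * (a / 2) <= N%:R * qf (A *m A) (cvec y) by rewrite ler_wpM2l// ltW.
  apply: le_trans h7 _; have e : 1 = (b - 1) + (2 - b) by ring.
  rewrite [leLHS]e.
  by apply: lerD; [exact: ltW h4|exact: le_trans h6 h8].
exists N%:R, N.+1%:R^-1; split; first by rewrite invr_gt0 ltr0n.
move=> w; have [->|w0] := eqVneq w 0.
  have q0 (X : 'M[C]_n) : qf X 0 = 0 by rewrite /qf !mul0mx mxE.
  by rewrite !q0 mulr0.
(* Both sides are homogeneous of degree 2, so [w] may be normalized. *)
have [t t0 t1] := qf_normalize w0; have [z zE] := cvec_surj (t%:C%C *: w).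
have /hN : S z by rewrite /S/= zE.
rewrite zE -qfZ -qfD; rewrite rmorph_nat -[leLHS]mulr1 -t1.
rewrite !qf_scale mulrCA ler_pM2l// exprn_gt0//.
Qed.
End Finsler.

(** * Strict increase of an eigenvalue under a first-order perturbation *)

Section Monotonicity.
Variables (R : realType) (K : base_field) (n : nat).
Local Notation F := (scalarF R K).
Local Notation C := R[i].

(** The summands bound the parts of the remainder [Rem] in [lambda_hat_shift_lt], where [K1] and [a]
    are the norms of [T] and [A0]. *)
Lemma shift_bound (del s K1 a : R) : 0 <= K1 -> 0 <= a -> 0 < s -> s < del -> del <= 1 ->
  del + (K1 * del + del * K1) + s * (K1 * (a + del) * K1) <=
  del * (1 + 2 * K1 + K1 * (a + 1) * K1).
Proof.
move=> k0 a0 s0 sd d1.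
have h : s * (K1 * (a + del) * K1) <= del * (K1 * (a + 1) * K1).
  apply: ler_pM => //; [exact: ltW| |exact: ltW|].
    by rewrite !mulr_ge0// addr_ge0// ltW// (lt_trans s0 sd).
  by rewrite ler_wpM2r// ler_wpM2l// lerD2l.
by move: (s * _) (K1 * (a + 1) * K1) h => x y; lra.
Qed.

Lemma congruence_expand (s : C) (T X M : 'M[C]_n) :
  (1%:M + s *: T) *m X *m (1%:M + s *: T) - M =
  (X - M) + s *: (T *m X + X *m T + s *: (T *m X *m T)).
Proof.
rewrite mulmxDl mul1mx -scalemxAl mulmxDr mulmx1 -!scalemxAr mulmxDl -scalemxAl.
move: (T *m X *m T) (X *m T) (T *m X) => P Q S.
by apply/matrixP => i j; rewrite !mxE; ring.
Qed.

(** Isolates the main first-order term [D0 + Q]; for [T] proportional to [A0], [Q] is the multiple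
    of [A0 *m A0] that Finsler's lemma adds to [D0]. *)
Lemma shift_expand (s : C) (T A0 D0 Del Gam S Q : 'M[C]_n) :
  T *m A0 + A0 *m T = Q ->
  s *: (D0 + Del) + s *: (T *m (A0 + Gam) + (A0 + Gam) *m T + S) =
  s *: ((D0 + Q) + (Del + (T *m Gam + Gam *m T) + S)).
Proof.
move=> <-; rewrite mulmxDl mulmxDr.
move: (T *m A0) (A0 *m T) (T *m Gam) (Gam *m T) => a b c d.
by apply/matrixP => i j; rewrite !mxE; ring.
Qed.

(* With [T = (tau / 2) A0] and [G = 1 + s T], the congruent matrix
   [G (A' - mu) G] exceeds [A - mu] by [s (D0 + tau A0^2) + o(s)], which Finsler's
   lemma makes positive definite; congruence preserves the inertia. *)
Lemma lambda_hat_shift_lt (A0 D0 : 'M[C]_n) : hadj A0 = A0 ->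
  (forall w, w != 0 -> w *m A0 = 0 -> 0 < qf D0 w) ->
  exists2 del : R, 0 < del & forall (A A' : 'M[F]_n) (k : 'I_n) (s mu : R),
    SymF A -> SymF A' -> 0 < s -> s < del -> mu = lambda_hat A k ->
    absmx (cplmx A' - (mu%:C%C)%:M - A0) < del ->
    absmx ((s^-1)%:C%C *: (cplmx A' - cplmx A) - D0) < del ->
    mu < lambda_hat A' k.
Proof.
move=> hA0 hD0; have [tau [c [c0 hc]]] := finsler hA0 hD0.
pose T := (tau / 2)%:C%C *: A0; have hT : hadj T = T by rewrite hadjZ hA0.
pose K1 := absmx T; have K10 : 0 <= K1 := absmx_ge0 T.
pose W := 1 + 2 * K1 + K1 * (absmx A0 + 1) * K1.
have W0 : 0 < W.
  rewrite /W -addrA ltr_pwDl// addr_ge0// ?mulr_ge0//.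
  by rewrite addr_ge0// absmx_ge0.
(* The bound 1 is a hypothesis of [shift_bound]; the factor 2 makes [del * W < c] strict. *)
exists (Num.min 1 (c / (2 * W))); first by rewrite lt_min ltr01/= divr_gt0// mulr_gt0.
set del := Num.min _ _.
have d1 : del <= 1 by rewrite ge_min lexx.
have dW : del * W < c.
  have : del * (2 * W) <= c by rewrite -ler_pdivlMr ?mulr_gt0// ge_min lexx orbT.
  by move: (del) (W) (c) c0; clear => x y z z0; lra.
move=> A A' k s mu sA sA' s0 sd muE h1 h2.
set G := 1%:M + s%:C%C *: T.
have hG : hadj G = G by rewrite hadjD hadj1 hadjZ hT.
apply: (@lambda_hat_lt R K n A A' G mu mu k sA sA'); first by rewrite muE.
move=> w w0.
set M' := cplmx A' - (mu%:C%C)%:M; set M := cplmx A - (mu%:C%C)%:M.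
rewrite -qf_mulmx -subr_gt0 -qfB.
set Gam := M' - A0 in h1; set Del := _ - D0 in h2.
have eM' : M' = A0 + Gam by rewrite /Gam addrC subrK.
have eD : M' - M = s%:C%C *: (D0 + Del).
  rewrite /Del [D0 + _]addrC subrK scalerA -rmorphM mulfV ?gt_eqF// scale1r.
  by rewrite /M' /M opprB addrA subrK.
have TA0 : T *m A0 + A0 *m T = tau%:C%C *: (A0 *m A0).
  rewrite /T -scalemxAl -scalemxAr -scalerDl -rmorphD; congr (_%:C%C *: _).
  by rewrite -splitr.
pose Rem := Del + (T *m Gam + Gam *m T) + s%:C%C *: (T *m M' *m T).
have -> : G *m M' *m hadj G - M = s%:C%C *: ((D0 + tau%:C%C *: (A0 *m A0)) + Rem).
  rewrite hG congruence_expand eD -(shift_expand _ _ _ _ _ TA0).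
  by rewrite -eM'.
rewrite qfZ mulr_gt0// qfD.
have hR : absmx Rem < c.
  apply: le_lt_trans dW; apply: le_trans (absmxD _ _) _.
  rewrite absmxZ gtr0_norm//.
  apply: le_trans (shift_bound K10 (absmx_ge0 A0) s0 sd d1).
  have del0 : 0 <= del by rewrite ltW// (lt_trans s0 sd).
  apply: lerD; last first.
    rewrite ler_wpM2l ?(ltW s0)//; apply: le_trans (absmxM _ _) _.
    rewrite ler_wpM2r//; apply: le_trans (absmxM _ _) _.
    rewrite ler_wpM2l// eM'; apply: le_trans (absmxD _ _) _.
    by rewrite lerD2l ltW.
  apply: le_trans (absmxD _ _) _; apply: lerD; first exact: ltW.
  apply: le_trans (absmxD _ _) _; apply: lerD.
    by apply: le_trans (absmxM _ _) _; rewrite ler_wpM2l// ltW.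
  by apply: le_trans (absmxM _ _) _; rewrite ler_wpM2r// ltW.
apply: lt_le_trans (lerD (hc w) (qf_ge_absmx Rem w)).
by rewrite subr_gt0 ltr_pM2r// qf1_gt0.
Qed.
End Monotonicity.

(** * Eigenvalues along differentiable families *)

Section LocalMonotonicity.
Variables (R : realType) (V : normedModType R).

Lemma ball_segment (x y z : V) (r t : R) : 0 <= t <= 1 ->
  ball x r y -> ball x r z -> ball x r (y + t *: (z - y)).
Proof.
move=> /andP[t0 t1]; rewrite -!ball_normE/= => hy hz.
have -> : x - (y + t *: (z - y)) = (1 - t) *: (x - y) + t *: (x - z).
  rewrite scalerBl scale1r !scalerBr; move: (t *: x) (t *: y) (t *: z) => a b c.
  by rewrite opprD addrA -[RHS]addrA; congr (_ + _); rewrite !opprB addrA subrK.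
apply: le_lt_trans (ler_normD _ _) _.
rewrite !normrZ (ger0_norm t0) ger0_norm ?subr_ge0//.
have [->|tn0] := eqVneq t 0; first by rewrite subr0 mul1r mul0r addr0.
have tp : 0 < t by rewrite lt_def tn0.
have h1 : t * `|x - z| < t * r by rewrite ltr_pM2l.
have h2 : (1 - t) * `|x - y| <= (1 - t) * r by rewrite ler_wpM2l ?subr_ge0// ltW.
by apply: lt_le_trans (ler_ltD h2 h1) _; rewrite -mulrDl subrK mul1r.
Qed.

Lemma directional_MVT (f : V -> R) (v x u : V) (r s : R) :
  (forall y, ball x r y -> differentiable f y) ->
  ball x r u -> ball x r (u + s *: v) -> 0 < s ->
  exists2 y, ball x r y & f (u + s *: v) - f u = s * 'D_v f y.
Proof.
move=> df bu bs s0.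
have bt t : 0 <= t <= s -> ball x r (u + t *: v).
  move=> /andP[t0 ts].
  have -> : u + t *: v = u + (t / s) *: (u + s *: v - u).
    by rewrite addrAC subrr add0r scalerA -mulrA mulVf ?mulr1// gt_eqF.
  by apply: ball_segment => //; rewrite divr_ge0 ?(ltW s0)//= ler_pdivrMr// mul1r.
pose g t := f (u + t *: v).
have quotE t : (fun h : R => h^-1 *: (g (h *: (1 : R^o) + t) - g t)) =
               (fun h : R => h^-1 *: (f (h *: v + (u + t *: v)) - f (u + t *: v))).
  apply/funext => h; rewrite /g; congr (_ *: (f _ - _)).
  by rewrite -[h *: (1 : R^o)]/(h * 1) mulr1 scalerDl addrCA.
have gder t : 0 <= t <= s -> is_derive t (1 : R^o) (g : R^o -> R^o) ('D_v f (u + t *: v)).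
  move=> /bt/df dft; have hd : derivable f (u + t *: v) v by exact: diff_derivable.
  split.
    by rewrite /derivable /= quotE.
  by rewrite /derive quotE.
have [||c cs] := @MVT_segment R g (fun t => 'D_v f (u + t *: v)) 0 s (ltW s0).
- by move=> t; rewrite in_itv/= => /andP[t0 ts]; apply: gder; rewrite !ltW.
- apply: continuous_in_subspaceT => t; rewrite inE/= in_itv/= => /gder[dg _].
  by apply: differentiable_continuous; apply/derivable1_diffP.
move: cs; rewrite in_itv/= subr0 /g scale0r addr0 => cs e.
by exists (u + c *: v); [exact: bt|rewrite e mulrC].
Qed.

Variables (K : base_field) (n : nat).
Local Notation F := (scalarF R K).

Lemma absmx_le (X : 'M[R[i]]_n) (e : R) : 0 < e ->
  (forall i j, `|complex.Re (X i j)| < e) -> (forall i j, `|complex.Im (X i j)| < e) ->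
  absmx X <= (n * n)%:R * (2 * e).
Proof.
move=> e0 h1 h2; rewrite natrM -mulrA.
have -> : n%:R * (n%:R * (2 * e)) = \sum_(i < n) \sum_(j < n) (2 * e).
  by rewrite !sumr_const !card_ord !mulr_natl.
apply: ler_sum => i _; apply: ler_sum => j _.
by rewrite /absc mulr_natl mulr2n lerD// ltW.
Qed.

Lemma absmx_cvg (A : V -> 'M[F]_n) (u : V) :
  (forall i j, {for u, continuous (fun y => reF (A y i j))}) ->
  (forall i j, {for u, continuous (fun y => imF (A y i j))}) ->
  forall e, 0 < e -> \forall y \near u, absmx (cplmx (A y) - cplmx (A u)) < e.
Proof.
move=> hre him e e0.
pose e' := e / ((n * n).+1%:R * 2).
have e'0 : 0 < e' by rewrite divr_gt0// mulr_gt0// ltr0n.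
have h1 : \forall y \near u, forall ij : 'I_n * 'I_n,
    `|reF (A u ij.1 ij.2) - reF (A y ij.1 ij.2)| < e'.
  by apply: filter_forall => ij; move/cvgrPdist_lt: (hre ij.1 ij.2); apply.
have h2 : \forall y \near u, forall ij : 'I_n * 'I_n,
    `|imF (A u ij.1 ij.2) - imF (A y ij.1 ij.2)| < e'.
  by apply: filter_forall => ij; move/cvgrPdist_lt: (him ij.1 ij.2); apply.
near=> y.
have h3 : forall ij : 'I_n * 'I_n, `|reF (A u ij.1 ij.2) - reF (A y ij.1 ij.2)| < e'.
  by near: y.
have h4 : forall ij : 'I_n * 'I_n, `|imF (A u ij.1 ij.2) - imF (A y ij.1 ij.2)| < e'.
  by near: y.
apply: le_lt_trans (absmx_le (e := e') e'0 _ _) _.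
- by move=> i j; rewrite !mxE/= distrC; exact: (h3 (i, j)).
- by move=> i j; rewrite !mxE/= distrC; exact: (h4 (i, j)).
rewrite mulrA /e' mulrA ltr_pdivrMr ?mulr_gt0// ?ltr0n// mulrC ltr_pM2l//.
by rewrite ltr_pM2r// ltr_nat.
Unshelve. all: by end_near. Qed.

Lemma lambda_hat_continuous (A : V -> 'M[F]_n) (k : 'I_n) (u : V) :
  (forall y, SymF (A y)) ->
  (forall i j, {for u, continuous (fun y => reF (A y i j))}) ->
  (forall i j, {for u, continuous (fun y => imF (A y i j))}) ->
  {for u, continuous (fun y => lambda_hat (A y) k)}.
Proof.
move=> sA hre him; apply/cvgrPdist_lt => e e0; near=> y.
rewrite distrC; apply: le_lt_trans (lambda_hat_lip k (sA u) (sA y)) _.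
by near: y; exact: absmx_cvg.
Unshelve. all: by end_near. Qed.

(** By the mean value theorem the entries of a difference quotient are derivatives along [v] at
    nearby points, hence close to [D0]. So [lambda_hat_shift_lt] applies at every base point near
    [u0], with the same [del]. *)
Lemma lambda_hat_increasing (A : V -> 'M[F]_n) (k : 'I_n) (u0 v : V) (O : set V) :
  nbhs u0 O -> v != 0 -> (forall y, SymF (A y)) ->
  (forall i j y, O y -> differentiable (fun y => reF (A y i j)) y) ->
  (forall i j y, O y -> differentiable (fun y => imF (A y i j)) y) ->
  (forall i j, {for u0, continuous (fun y => 'D_v (fun y => reF (A y i j)) y)}) ->
  (forall i j, {for u0, continuous (fun y => 'D_v (fun y => imF (A y i j)) y)}) ->
  let D0 : 'M[R[i]]_n := \matrix_(i, j)
    Complex ('D_v (fun y => reF (A y i j)) u0) ('D_v (fun y => imF (A y i j)) u0) in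
  (forall w, w != 0 ->
     w *m (cplmx (A u0) - ((lambda_hat (A u0) k)%:C%C)%:M) = 0 -> 0 < qf D0 w) ->
  exists r : R, [/\ 0 < r, ball u0 r `<=` O &
    forall u s, ball u0 r u -> 0 < s -> ball u0 r (u + s *: v) ->
      lambda_hat (A u) k < lambda_hat (A (u + s *: v)) k].
Proof.
move=> Ou0 v0 sA dre dim cDre cDim D0 hD0.
have Ou0' := nbhs_singleton Ou0.
set lam := lambda_hat (A u0) k in hD0.
set A0 := cplmx (A u0) - _ in hD0.
have hA0 : hadj A0 = A0.
  have -> : A0 = cplmx (A u0) + ((- lam)%:C%C)%:M by rewrite rmorphN raddfN.
  by rewrite hadjD hadj_scalar cplmx_herm.
have [del del0 hdel] := @lambda_hat_shift_lt R K n A0 D0 hA0 hD0.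
(* The change of the matrix costs one [e1], that of the scalar matrix of the eigenvalue [n * e1];
   one [e1] is left over. *)
pose e1 := del / n.+2%:R; have e10 : 0 < e1 by rewrite divr_gt0// ltr0n.
pose e2 := del / ((n * n).+1%:R * 2).
have e20 : 0 < e2 by rewrite divr_gt0// mulr_gt0// ltr0n.
have near1 : \forall y \near u0, absmx (cplmx (A y) - cplmx (A u0)) < e1.
  apply: absmx_cvg => // i j.
    exact: (differentiable_continuous (dre i j u0 Ou0')).
  exact: (differentiable_continuous (dim i j u0 Ou0')).
have near2 : \forall y \near u0, forall ij : 'I_n * 'I_n,
    `|'D_v (fun y => reF (A y ij.1 ij.2)) u0 - 'D_v (fun y => reF (A y ij.1 ij.2)) y| < e2.
  by apply: filter_forall => ij; move/cvgrPdist_lt: (cDre ij.1 ij.2); apply.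
have near3 : \forall y \near u0, forall ij : 'I_n * 'I_n,
    `|'D_v (fun y => imF (A y ij.1 ij.2)) u0 - 'D_v (fun y => imF (A y ij.1 ij.2)) y| < e2.
  by apply: filter_forall => ij; move/cvgrPdist_lt: (cDim ij.1 ij.2); apply.
have /nbhs_ballP[r0 /= r00 hr0] : \forall y \near u0, [/\ O y,
    absmx (cplmx (A y) - cplmx (A u0)) < e1,
    (forall ij : 'I_n * 'I_n, `|'D_v (fun y => reF (A y ij.1 ij.2)) u0 -
       'D_v (fun y => reF (A y ij.1 ij.2)) y| < e2) &
    (forall ij : 'I_n * 'I_n, `|'D_v (fun y => imF (A y ij.1 ij.2)) u0 -
       'D_v (fun y => imF (A y ij.1 ij.2)) y| < e2)].
  by near=> y; split; near: y.
have nv : 0 < `|v| by rewrite normr_gt0.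
(* Two points of the ball are less than [2 * r] apart, so the second bound forces [s < del]. *)
pose r := Num.min r0 (del * `|v| / 2).
have rr0 y : ball u0 r y -> ball u0 r0 y.
  by apply: le_ball; rewrite ge_min lexx.
exists r; split.
- by rewrite lt_min r00/= divr_gt0// mulr_gt0.
- by move=> y /rr0/hr0[].
move=> u s bu s0 bs.
have [_ hu _ _] := hr0 _ (rr0 _ bu); have [_ hs _ _] := hr0 _ (rr0 _ bs).
apply: (hdel (A u) _ k s (lambda_hat (A u) k) (sA _) (sA _) s0) => //.
- have : s * `|v| < del * `|v|.
    have -> : s * `|v| = `|(u + s *: v - u0) + (u0 - u)|.
      by rewrite addrA subrK addrAC subrr add0r normrZ gtr0_norm.
    apply: le_lt_trans (ler_normD _ _) _; rewrite distrC.
    move: bu bs; rewrite -ball_normE/= => bu bs.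
    have rle : r <= del * `|v| / 2 by rewrite ge_min lexx orbT.
    rewrite [ltRHS]splitr; apply: ltrD.
      exact: lt_le_trans bs rle.
    exact: lt_le_trans bu rle.
  by rewrite ltr_pM2r.
- set mu := lambda_hat _ _.
  have -> : cplmx (A (u + s *: v)) - (mu%:C%C)%:M - A0 =
      (cplmx (A (u + s *: v)) - cplmx (A u0)) + ((lam - mu)%:C%C)%:M.
    by rewrite scalar_mxB /A0 subrBB.
  apply: le_lt_trans (absmxD _ _) _; rewrite absmx_scalar distrC.
  have hm : `|mu - lam| <= e1.
    by apply: le_trans (lambda_hat_lip k (sA u0) (sA u)) _; exact: ltW.
  have : del = e1 + n%:R * e1 + e1.
    have -> : e1 + n%:R * e1 + e1 = e1 * n.+2%:R by rewrite -!natr1; ring.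
    by rewrite /e1 divfK// pnatr_eq0.
  move=> ->.
  rewrite -addrA ltr_leD//; last first.
    by apply: le_trans (ler_wpM2l _ hm) _ => //; rewrite lerDl ltW.
- apply: le_lt_trans (absmx_le (e := e2) e20 _ _) _ => [i j|i j|].
  + have [y hy ey] := directional_MVT
      (fun y h => dre i j y (let: And4 Oy _ _ _ := hr0 _ (rr0 _ h) in Oy)) bu bs s0.
    rewrite !mxE/= mul0r subr0 ey mulKf ?gt_eqF// distrC.
    by have [_ _ /(_ (i, j)) + _] := hr0 _ (rr0 _ hy).
  + have [y hy ey] := directional_MVT
      (fun y h => dim i j y (let: And4 Oy _ _ _ := hr0 _ (rr0 _ h) in Oy)) bu bs s0.
    rewrite !mxE/= mul0r addr0 ey mulKf ?gt_eqF// distrC.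
    by have [_ _ _ /(_ (i, j))] := hr0 _ (rr0 _ hy).
rewrite mulrA /e2 mulrA ltr_pdivrMr ?mulr_gt0// ?ltr0n// mulrC ltr_pM2l//.
by rewrite ltr_pM2r// ltr_nat.
Unshelve. all: by end_near. Qed.
End LocalMonotonicity.

(** * Deformation of a box along an increasing direction *)

Section FlowBox.
Variables (R : realType) (d : nat) (i0 : 'I_d).
Local Notation V := 'rV[R]_d.
Local Notation B := (ball (0 : V) 1).
Local Notation e0 := (delta_mx 0 i0 : V).

Lemma cubeP (z : V) : B z <-> forall j, `|z 0 j| < 1.
Proof.
split=> [[_ h] j|h]; first by have := h 0 j; rewrite /ball/= mxE sub0r normrN.
by split=> // i j; rewrite ord1 /ball/= mxE sub0r normrN.
Qed.

Definition set_coord (z : V) (t : R) : V := z + (t - z 0 i0) *: e0.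

Lemma set_coordE z t j : set_coord z t 0 j = if j == i0 then t else z 0 j.
Proof.
rewrite !mxE eqxx/=; case: eqP => [->|_]; last by rewrite mulr0 addr0.
by rewrite mulr1 addrC subrK.
Qed.

Lemma set_coord_id z : set_coord z (z 0 i0) = z.
Proof. by rewrite /set_coord subrr scale0r addr0. Qed.

Lemma set_coordB z t t' : set_coord z t = set_coord z t' + (t - t') *: e0.
Proof. by rewrite /set_coord -addrA -scalerDl; congr (_ + _ *: _); ring. Qed.

Lemma set_coord_cube z t : B z -> `|t| < 1 -> B (set_coord z t).
Proof. by move=> /cubeP h t1; apply/cubeP => j; rewrite set_coordE; case: ifP. Qed.

Lemma set_coord_continuous t : continuous (set_coord^~ t).
Proof.
move=> z; have h : y @[y --> z] --> z by [].
have h0 : (fun y : V => y 0 i0) @ z --> z 0 i0 by exact: coord_continuous.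
exact: (cvgD h (cvgZr_tmp (a := e0) (cvgB (cvg_cst t) h0))).
Qed.

Variables (phi : V -> R) (c : R).
Hypotheses (phi_cont : forall z, B z -> {for z, continuous phi})
  (phi_mono : forall z s, B z -> 0 < s -> B (z + s *: e0) ->
     phi z < phi (z + s *: e0))
  (phi_low : forall z, B z -> z 0 i0 = - 2^-1 -> phi z < c)
  (phi_high : forall z, B z -> z 0 i0 = 2^-1 -> c < phi z).

Lemma half_lt1 : (2^-1 : R) < 1.
Proof. by rewrite invf_lt1// ltr1n. Qed.

Lemma set_coord_lt z t t' : B z -> `|t| < 1 -> `|t'| < 1 -> t < t' ->
  phi (set_coord z t) < phi (set_coord z t').
Proof.
move=> Bz t1 t1' tt'; rewrite (set_coordB z t' t); apply: phi_mono.
- exact: set_coord_cube.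
- by rewrite subr_gt0.
- by rewrite -set_coordB; exact: set_coord_cube.
Qed.

Lemma set_coord_le z t t' : B z -> `|t| < 1 -> `|t'| < 1 -> t <= t' ->
  phi (set_coord z t) <= phi (set_coord z t').
Proof.
move=> Bz t1 t1'; rewrite le_eqVlt => /predU1P[->//|tt'].
by apply/ltW/set_coord_lt.
Qed.

Lemma crossing_ex z : B z ->
  exists t, `|t| < 2^-1 /\ phi (set_coord z t) = c.
Proof.
move=> Bz; have h1 := half_lt1.
have half0 : 0 < (2^-1 : R) by rewrite invr_gt0.
have low : phi (set_coord z (- 2^-1)) < c.
  apply: phi_low; rewrite ?set_coordE ?eqxx//; apply: set_coord_cube => //.
  by rewrite normrN gtr0_norm.
have high : c < phi (set_coord z 2^-1).
  apply: phi_high; rewrite ?set_coordE ?eqxx//; apply: set_coord_cube => //.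
  by rewrite gtr0_norm.
have [|||t tI tc] := @IVT R (fun t => phi (set_coord z t)) (- 2^-1) 2^-1 c.
- by rewrite lerNl (le_trans _ (ltW half0))// oppr_le0 ltW.
- apply: continuous_in_subspaceT => t; rewrite inE/= in_itv/= => /andP[t1 t2].
  apply: (@continuous_comp _ _ _ (set_coord z) phi); last first.
    by apply/phi_cont/set_coord_cube => //; rewrite (le_lt_trans _ h1)// ler_norml t1.
  have h : y @[y --> t] --> t by [].
  exact: (cvgD (cvg_cst z) (cvgZr_tmp (a := e0) (cvgB h (cvg_cst (z 0 i0))))).
- by rewrite ge_min (ltW low)/= le_max (ltW high) orbT.
exists t; split=> //; move: tI; rewrite in_itv/= => /andP[t1 t2].
rewrite ltr_norml !lt_neqAle t1 t2 !andbT; apply/andP; split.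
  by apply/eqP => e; move: low; rewrite e tc ltxx.
by apply/eqP => e; move: high; rewrite -e tc ltxx.
Qed.

(** The height at which the line through [z] along [e0] meets the level [c]. In the cube it exists
    by the intermediate value theorem and is unique by strict monotonicity. *)
Definition crossing (z : V) : R :=
  xget 0 [set t | `|t| < 2^-1 /\ phi (set_coord z t) = c].

Lemma crossingP z : B z ->
  `|crossing z| < 2^-1 /\ phi (set_coord z (crossing z)) = c.
Proof.
move=> /crossing_ex[t ht].
exact: (@xgetI R 0 [set t | `|t| < 2^-1 /\ phi (set_coord z t) = c] t).
Qed.

Lemma crossing_lt1 z : B z -> `|crossing z| < 1.
Proof. by move=> /crossingP[/lt_trans + _]; apply; exact: half_lt1. Qed.

Lemma lt_crossing z t : B z -> `|t| < 1 -> (phi (set_coord z t) < c) = (t < crossing z).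
Proof.
move=> Bz t1; have [_ hc] := crossingP Bz; have h1 := crossing_lt1 Bz.
apply/idP/idP => [|tc]; last by rewrite -[X in _ < X]hc set_coord_lt.
by apply: contraTT; rewrite -!leNgt => ct; rewrite -[X in X <= _]hc set_coord_le.
Qed.

Lemma gt_crossing z t : B z -> `|t| < 1 -> (c < phi (set_coord z t)) = (crossing z < t).
Proof.
move=> Bz t1; have [_ hc] := crossingP Bz; have h1 := crossing_lt1 Bz.
apply/idP/idP => [|tc]; last by rewrite -[X in X < _]hc set_coord_lt.
by apply: contraTT; rewrite -!leNgt => ct; rewrite -[X in _ <= X]hc set_coord_le.
Qed.

Lemma cube_nbhs z : B z -> \forall z' \near z, B z'.
Proof. by move=> Bz; apply: open_nbhs_nbhs; split => //; exact: ball_open. Qed.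

(** By monotonicity [crossing z < t] means that [phi] exceeds [c] at height [t], an open condition
    on [z]; likewise from below. Heights outside the open interval from -1/2 to 1/2 are treated
    apart, since crossings stay inside it. *)
Lemma crossing_continuous z : B z -> {for z, continuous crossing}.
Proof.
move=> Bz; have h1 := half_lt1; have half0 : 0 < (2^-1 : R) by rewrite invr_gt0.
have cphi t : `|t| < 1 -> {for z, continuous (phi \o set_coord^~ t)}.
  move=> t1; apply: (@continuous_comp _ _ _ (set_coord^~ t) phi).
    exact: set_coord_continuous.
  exact/phi_cont/set_coord_cube.
have upper t : crossing z < t -> \forall z' \near z, crossing z' < t.
  move=> ct; have [t2|t2] := leP 2^-1 t.
    near=> z'; apply: lt_le_trans t2.
    have [|h _] := @crossingP z'; first by near: z'; exact: cube_nbhs.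
    by move: h; rewrite ltr_norml => /andP[].
  have t1 : `|t| < 1.
    rewrite ltr_norml (lt_trans t2 h1) andbT (lt_trans _ ct)//.
    by have := crossing_lt1 Bz; rewrite ltr_norml => /andP[].
  near=> z'.
  have Bz' : B z' by near: z'; exact: cube_nbhs.
  rewrite -gt_crossing//; near: z'.
  by apply: (cvgr_gt (phi (set_coord z t))); [exact: cphi|rewrite gt_crossing].
have lower t : t < crossing z -> \forall z' \near z, t < crossing z'.
  move=> ct; have [t2|t2] := leP t (- 2^-1).
    near=> z'; apply: le_lt_trans t2 _.
    have [|h _] := @crossingP z'; first by near: z'; exact: cube_nbhs.
    by move: h; rewrite ltr_norml => /andP[].
  have t1 : `|t| < 1.
    rewrite ltr_norml (lt_trans _ t2) ?ltrN2//= (lt_trans ct)//.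
    by have := crossing_lt1 Bz; rewrite ltr_norml => /andP[].
  near=> z'.
  have Bz' : B z' by near: z'; exact: cube_nbhs.
  rewrite -lt_crossing//; near: z'.
  by apply: (cvgr_lt (phi (set_coord z t))); [exact: cphi|rewrite lt_crossing].
suff h : forall e, 0 < e -> \forall z' \near nbhs z, `|crossing z - crossing z'| < e.
  exact: (cvgrPdist_lt (F := nbhs z) _ _).2.
move=> e e_gt0.
have el : \forall z' \near z, crossing z - e < crossing z'.
  by apply: lower; rewrite ltrBlDr ltrDl.
have eu : \forall z' \near z, crossing z' < crossing z + e.
  by apply: upper; rewrite ltrDl.
apply: (@filterS2 V (nbhs z) _ _ _ _ _ el eu) => z' h3 h4.
by rewrite ltr_distlC h3.
Unshelve. all: by end_near. Qed.

(** At time [u.1] the point has descended by that fraction of its height above the level surface;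
    the [max] fixes the points on or below it. *)
Definition flow (u : R * V) : V :=
  u.2 - (u.1 * Num.max 0 (u.2 0 i0 - crossing u.2)) *: e0.

Lemma flowE u : flow u =
  set_coord u.2 (u.2 0 i0 - u.1 * Num.max 0 (u.2 0 i0 - crossing u.2)).
Proof. by rewrite /flow /set_coord addrAC subrr add0r scaleNr. Qed.

Lemma flow_continuous u : B u.2 -> {for u, continuous flow}.
Proof.
move=> Bu.
have csnd : {for u, continuous (snd : R * V -> V)} by exact: cvg_snd.
have ccoord : {for u, continuous (fun u : R * V => u.2 0 i0)}.
  by apply: (@continuous_comp _ _ _ snd (fun z : V => z 0 i0)) => //; exact: coord_continuous.
have ccross : {for u, continuous (fun u : R * V => crossing u.2)}.
  by apply: (@continuous_comp _ _ _ snd crossing) => //; exact: crossing_continuous.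
have cmax : {for u, continuous (fun u : R * V => Num.max 0 (u.2 0 i0 - crossing u.2))}.
  apply: (@continuous_max _ _ (cst 0) (fun u : R * V => u.2 0 i0 - crossing u.2)).
    exact: cvg_cst.
  exact: (cvgB ccoord ccross).
have cfst : {for u, continuous (fst : R * V -> R)} by exact: cvg_fst.
exact: (cvgB csnd (cvgZr_tmp (a := e0) (cvgM cfst cmax))).
Qed.

Lemma flow_bounds t z : B z -> 0 <= t <= 1 ->
  let s := z 0 i0 - t * Num.max 0 (z 0 i0 - crossing z) in
  `|s| < 1 /\ s <= z 0 i0.
Proof.
move=> Bz /andP[t0 t1] s.
have /cubeP/(_ i0) := Bz; rewrite ltr_norml => /andP[z1 z2].
have := crossing_lt1 Bz; rewrite ltr_norml => /andP[c1 c2].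
rewrite ltr_norml /s; move: (crossing z) (z 0 i0) c1 c2 z1 z2 => k y *.
case: (leP 0 (y - k)) => h; last first.
  by rewrite mulr0 subr0; split=> //; apply/andP.
have := mulr_ge0 t0 h; have := ler_piMl h t1.
by move: (t * _) => p *; split; [apply/andP; split|]; lra.
Qed.

Lemma flow_cube t z : B z -> 0 <= t <= 1 -> B (flow (t, z)).
Proof.
move=> Bz t01; rewrite flowE/=; apply: set_coord_cube => //.
by have [] := flow_bounds Bz t01.
Qed.

Lemma flow_le t z : B z -> 0 <= t <= 1 -> phi (flow (t, z)) <= phi z.
Proof.
move=> Bz t01; rewrite flowE/= -[X in _ <= phi X]set_coord_id.
have [? ?] := flow_bounds Bz t01; apply: set_coord_le => //.
by have /cubeP := Bz.
Qed.

Lemma flow0 z : flow (0, z) = z.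
Proof. by rewrite /flow/= mul0r scale0r subr0. Qed.

Lemma flow1 z : B z -> phi (flow (1, z)) <= c.
Proof.
move=> Bz; rewrite flowE/= mul1r; have [_ cE] := crossingP Bz.
have c1 := crossing_lt1 Bz; have /cubeP/(_ i0) z1 := Bz.
case: (leP 0 (_ - _)) => h; first by rewrite subKr cE.
by rewrite subr0 -[X in _ <= X]cE set_coord_le// -subr_le0 ltW.
Qed.

Lemma flow_fix t z : B z -> phi z <= c -> flow (t, z) = z.
Proof.
move=> Bz; rewrite leNgt -{1}(set_coord_id z) gt_crossing; last first.
- by have /cubeP := Bz.
- exact: Bz.
rewrite -leNgt -subr_le0 /flow/= => h.
by rewrite (max_idPl h) mulr0 scale0r subr0.
Qed.

End FlowBox.

(** The flow, transported by the homeomorphism, never raises [phi], so it stays in the larger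
    sublevel set; at time 1 it has reached the smaller one, whose points it never moves. *)
Lemma flow_box_retract (R : realType) (d : nat) (i0 : 'I_d) (M : topologicalType)
    (U : set M) (f : M -> 'rV[R]_d) (g : 'rV[R]_d -> M) (phi : M -> R) (c c' : R) :
  let B := ball (0 : 'rV[R]_d) 1 in let e0 := delta_mx 0 i0 in
  (forall y, U y -> B (f y) /\ g (f y) = y) ->
  (forall z, B z -> U (g z) /\ f (g z) = z) ->
  (forall y, U y -> {for y, continuous f}) ->
  (forall z, B z -> {for z, continuous g}) ->
  (forall z, B z -> {for z, continuous (phi \o g)}) ->
  (forall z s, B z -> 0 < s -> B (z + s *: e0) -> phi (g z) < phi (g (z + s *: e0))) ->
  (forall z, B z -> z 0 i0 = - 2^-1 -> phi (g z) < c) ->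
  (forall z, B z -> z 0 i0 = 2^-1 -> c < phi (g z)) ->
  c <= c' ->
  strong_deformation_retract R (U `&` [set y | phi y <= c]) (U `&` [set y | phi y <= c']).
Proof.
move=> B e0 fP gP fc gc phic mono low high cc'.
split; first by move=> y [Uy /= yc]; split=> //=; exact: le_trans cc'.
pose F := flow i0 (phi \o g) c.
have BF t y : 0 <= t <= 1 -> U y -> B (F (t, f y)).
  by move=> t01 /fP[Bfy _]; exact: (flow_cube phic low high).
exists (fun u => g (F (u.1, f u.2))); split.
- apply: continuous_in_subspaceT => -[t y]; rewrite inE => -[/= t01 [Uy _]].
  apply: (@continuous_comp _ _ _ (fun u : R * M => F (u.1, f u.2)) g); last first.
    exact/gc/BF.
  apply: (@continuous_comp _ _ _ (fun u : R * M => (u.1, f u.2)) F); last first.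
    by apply: (flow_continuous phic mono low high); exact: (fP _ Uy).1.
  have cf : {for (t, y), continuous (fun u : R * M => f u.2)}.
    apply: (@continuous_comp _ _ _ (snd : R * M -> M) f); first exact: cvg_snd.
    exact: fc.
  have cfst : {for (t, y), continuous (fst : R * M -> R)} by exact: cvg_fst.
  exact: (cvg_pair cfst cf).
- move=> t y t01 [Uy yc']; have [Bfy gfy] := fP _ Uy; split=> /=.
    exact: (gP _ (BF _ _ t01 Uy)).1.
  apply: le_trans yc'; rewrite -[in leRHS]gfy.
  exact: (flow_le phic mono low high).
- by move=> y [Uy _]; rewrite /F flow0 (fP _ Uy).2.
- move=> y [Uy _]; have [Bfy gfy] := fP _ Uy; split => /=.
    by apply: (gP _ (BF _ _ _ Uy)).1; rewrite ler01 lexx.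
  exact: (flow1 phic mono low high).
- move=> t y _ [Uy yc]; have [Bfy gfy] := fP _ Uy.
  by rewrite /F (flow_fix phic mono low high)//= gfy.
Qed.

(** * Affine boxes along a direction and regular points *)

Section AffineBox.
Variables (R : realType) (d : nat) (i0 : 'I_d) (x0 v : 'rV[R]_d) (a b : R).
Local Notation V := 'rV[R]_d.
Local Notation e0 := (delta_mx 0 i0 : V).
Hypotheses (v0 : v 0 i0 != 0) (a0 : 0 < a) (b0 : 0 < b).

(** Coordinate [i0] runs along [a *: v] and the others are scaled by [b], so [b] alone controls the
    thickness. It is invertible because [v 0 i0] is nonzero. *)
Definition box_map (z : V) : V :=
  x0 + (b *: (z - z 0 i0 *: e0) + (z 0 i0 * a) *: v).

(** The transverse part of [box_map z] has zero entry at [i0], so this entry alone gives back the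
    height. *)
Definition box_coord (u : V) : R := (u - x0) 0 i0 / (a * v 0 i0).

Definition box_inv (u : V) : V :=
  b^-1 *: (u - x0 - (box_coord u * a) *: v) + box_coord u *: e0.

Lemma box_inv_i0 u : box_inv u 0 i0 = box_coord u.
Proof.
have e : (u - x0) 0 i0 = box_coord u * a * v 0 i0.
  by rewrite /box_coord -mulrA divfK// mulf_neq0// gt_eqF.
rewrite /box_inv; move: (box_coord u) e => t; rewrite !mxE !eqxx mulr1 => ->.
by rewrite subrr mulr0 add0r.
Qed.

Lemma box_invK u : box_map (box_inv u) = u.
Proof.
rewrite /box_map box_inv_i0 {1}/box_inv addrK scalerA mulfV ?gt_eqF// scale1r.
by rewrite subrK addrC subrK.
Qed.

Lemma box_mapK z : box_inv (box_map z) = z.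
Proof.
have e : box_map z - x0 = b *: (z - z 0 i0 *: e0) + (z 0 i0 * a) *: v.
  by rewrite /box_map addrAC subrr add0r.
have t : box_coord (box_map z) = z 0 i0.
  rewrite /box_coord e !mxE !eqxx mulr1 subrr mulr0 add0r -(mulrA (z 0 i0)) mulfK//.
  by rewrite mulf_neq0// gt_eqF.
rewrite /box_inv e t addrK scalerA mulVf ?gt_eqF// scale1r.
by rewrite subrK.
Qed.

Lemma box_mapD z s : box_map (z + s *: e0) = box_map z + (s * a) *: v.
Proof.
rewrite /box_map !mxE !eqxx mulr1.
rewrite scalerDl opprD addrACA subrr addr0 mulrDl scalerDl.
by rewrite !addrA.
Qed.

Lemma box_map0 : box_map 0 = x0.
Proof. by rewrite /box_map mxE mul0r !scale0r subrr scaler0 !addr0. Qed.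

Lemma box_map_continuous : continuous box_map.
Proof.
move=> z; have h : y @[y --> z] --> z by [].
have h0 : (fun y : V => y 0 i0) @ z --> z 0 i0 by exact: coord_continuous.
exact: (cvgD (cvg_cst x0) (cvgD (cvgZl_tmp (k := b) (cvgB h (cvgZr_tmp (a := e0) h0)))
  (cvgZr_tmp (a := v) (cvgM h0 (cvg_cst a))))).
Qed.

Lemma box_inv_continuous : continuous box_inv.
Proof.
move=> u; have h : y @[y --> u] --> u by [].
have h1 : (fun y : V => y - x0) @ u --> u - x0 by exact: (cvgB h (cvg_cst x0)).
have h0 : box_coord @ u --> box_coord u.
  have h2 : (fun y : V => (y - x0) 0 i0) @ u --> (u - x0) 0 i0.
    apply: (@continuous_comp _ _ _ (fun y : V => y - x0) (fun y : V => y 0 i0)).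
      exact: h1.
    exact: coord_continuous.
  exact: (cvgM h2 (cvg_cst (a * v 0 i0)^-1)).
exact: (cvgD (cvgZl_tmp (k := b^-1) (cvgB h1
  (cvgZr_tmp (a := v) (cvgM h0 (cvg_cst a))))) (cvgZr_tmp (a := e0) h0)).
Qed.

Lemma box_map_dist z t : ball (0 : V) 1 z -> z 0 i0 = t ->
  `|(x0 + (t * a) *: v) - box_map z| < b * (1 + `|e0|).
Proof.
move=> Bz <-; rewrite /box_map opprD addrACA subrr add0r opprD addrCA subrr addr0.
rewrite normrN normrZ gtr0_norm// ltr_pM2l//.
have z1 : `|z| < 1 by move: Bz; rewrite -ball_normE/= sub0r normrN.
have zi : `|z 0 i0| <= 1 by move/cubeP: Bz => /(_ i0)/ltW.
apply: le_lt_trans (ler_normB _ _) _; rewrite normrZ ltr_leD//.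
by rewrite -[leRHS]mul1r ler_wpM2r.
Qed.
End AffineBox.

(** Along the axis, [phi] is below [phi x] at [um] and above it at [up]. In a thin box a level [cc]
    just below [phi x] still separates the whole slices through these points, as [flow_box_retract]
    requires. *)
Lemma topologically_regular_increasing (R : realType) (d : nat)
    (M : smooth_manifold R d) (phi : M -> R) (x : M) (c : chart R d M)
    (v : 'rV[R]_d) (r : R) :
  chart_dom c x -> v != 0 -> 0 < r ->
  let B0 := ball (to_chart c x) r in
  B0 `<=` chart_cod c ->
  (forall u, B0 u -> {for u, continuous (phi \o of_chart c)}) ->
  (forall u s, B0 u -> 0 < s -> B0 (u + s *: v) ->
     phi (of_chart c u) < phi (of_chart c (u + s *: v))) ->
  topologically_regular phi x.
Proof.
move=> cx /rV0Pn[i0 vi0] r0 B0 B0O cphi mono.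
set x0 := to_chart c x in B0 B0O cphi mono *.
have [toP ofP to_cont of_cont] := chart_homeo c.
have to_cont' y : chart_dom c y -> {for y, continuous (to_chart c)}.
  move=> cy; move: to_cont; rewrite continuous_open_subspace; last exact: chart_dom_open.
  by apply; rewrite inE.
have of_cont' u : chart_cod c u -> {for u, continuous (of_chart c)}.
  move=> cu; move: of_cont; rewrite continuous_open_subspace; last exact: chart_cod_open.
  by apply; rewrite inE.
have ofx0 : of_chart c x0 = x by exact: (toP x cx).2.
pose psi := phi \o of_chart c.
have v0 : 0 < `|v|.
  by rewrite normr_gt0; apply: contra vi0 => /eqP ->; rewrite mxE.
have B0P u : B0 u <-> `|x0 - u| < r by rewrite /B0 -ball_normE.
(* Half of the radius is spent on the axis, the other half on the thickness. *)
pose a := r / (2 * `|v|); have a0 : 0 < a by rewrite divr_gt0// mulr_gt0.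
have av : a * `|v| = r / 2 by rewrite /a invfM mulrA mulfVK// gt_eqF.
have half0 : 0 < (2^-1 : R) by rewrite invr_gt0.
have hin t : `|t| <= 1 -> B0 (x0 + (t * a) *: v).
  move=> t1; apply/B0P; rewrite opprD addrA subrr sub0r normrN normrZ normrM.
  rewrite (gtr0_norm a0) -mulrA av; apply: (@le_lt_trans _ _ (r / 2)).
    by rewrite -[leRHS]mul1r ler_wpM2r// divr_ge0// ltW.
  by rewrite ltr_pdivrMr// mulr_natr mulr2n ltrDl.
have B0x : B0 x0 by have := hin 0; rewrite mul0r scale0r addr0 normr0; apply.
set um := x0 + (- 2^-1 * a) *: v; set up := x0 + (2^-1 * a) *: v.
have hum : B0 um by apply: hin; rewrite normrN gtr0_norm// ltW// half_lt1.
have hup : B0 up by apply: hin; rewrite gtr0_norm// ltW// half_lt1.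
have sa0 : 0 < 2^-1 * a by rewrite mulr_gt0.
have lowlt : psi um < psi x0.
  have e : x0 = um + (2^-1 * a) *: v.
    by rewrite /um mulNr scaleNr subrK.
  by rewrite [in ltRHS]e; apply: mono => //; rewrite -e.
have highlt : psi x0 < psi up by exact: mono.
pose cc := (psi um + psi x0) / 2.
have cc1 : psi um < cc by rewrite midf_lt.
have cc2 : cc < psi x0 by rewrite midf_lt.
have [e1 /= e10 he1] : exists2 e : R, 0 < e & ball um e `<=` [set u | psi u < cc].
  apply/nbhs_ballP; exact: (cvgr_lt _ (cphi _ hum)).
have [e2 /= e20 he2] : exists2 e : R, 0 < e & ball up e `<=` [set u | cc < psi u].
  apply/nbhs_ballP; apply: (cvgr_gt _ (cphi _ hup)); exact: lt_trans highlt.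
pose N : R := 1 + `|delta_mx 0 i0 : 'rV[R]_d|.
have N0 : 0 < N by rewrite ltr_pwDl.
(* Thin enough to stay in the ball and to keep the slices at heights -1/2 and 1/2 within [e1] of
   [um] and [e2] of [up]. *)
pose b := Num.min (r / 2) (Num.min e1 e2) / N.
have b0 : 0 < b by rewrite divr_gt0// !lt_min e10 e20 divr_gt0.
have bN : b * N = Num.min (r / 2) (Num.min e1 e2) by rewrite divfK// gt_eqF.
have bN1 : b * N <= r / 2 by rewrite bN ge_min lexx.
have bN2 : b * N <= e1 by rewrite bN !ge_min lexx !orbT.
have bN3 : b * N <= e2 by rewrite bN !ge_min lexx !orbT.
pose T := box_map i0 x0 v a b; pose S := box_inv i0 x0 v a b.
have TS u : T (S u) = u by exact: box_invK.
have ST z : S (T z) = z by exact: box_mapK.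
have Tdist z t := @box_map_dist R d i0 x0 v a b b0 z t.
have TB z : ball (0 : 'rV[R]_d) 1 z -> B0 (T z).
  move=> Bz; apply/B0P; have h := Tdist z _ Bz erefl.
  have -> : x0 - T z = (x0 + (z 0 i0 * a) *: v - T z) - (z 0 i0 * a) *: v.
    by rewrite [RHS]addrAC addrK.
  apply: le_lt_trans (ler_normB _ _) _.
  rewrite [ltRHS]splitr; apply: ltr_leD; first exact: lt_le_trans h bN1.
  rewrite normrZ normrM (gtr0_norm a0) -mulrA av -[leRHS]mul1r ler_wpM2r//.
    by rewrite divr_ge0// ltW.
  by move/cubeP: Bz => /(_ i0)/ltW.
have S0 : S x0 = 0 by rewrite -[x0](box_map0 i0 x0 v a b) ST.
pose U := [set y | chart_dom c y /\ ball (0 : 'rV[R]_d) 1 (S (to_chart c y))].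
pose f y := S (to_chart c y); pose g z := of_chart c (T z).
have fP y : U y -> ball (0 : 'rV[R]_d) 1 (f y) /\ g (f y) = y.
  by move=> [cy By]; split=> //; rewrite /g /f TS; exact: (toP y cy).2.
have gP z : ball (0 : 'rV[R]_d) 1 z -> U (g z) /\ f (g z) = z.
  move=> /[dup] Bz /TB/B0O/ofP[h1 h2].
  by rewrite /U/= /f /g h2 ST.
have fc y : chart_dom c y -> {for y, continuous f}.
  move=> cy; apply: (@continuous_comp _ _ _ (to_chart c) S); first exact: to_cont'.
  exact: box_inv_continuous.
have gc z : ball (0 : 'rV[R]_d) 1 z -> {for z, continuous g}.
  move=> /TB/B0O Oz; apply: (@continuous_comp _ _ _ T (of_chart c)).
    exact: box_map_continuous.
  exact: of_cont'.
have phixE : phi x = psi x0 by rewrite /psi/= ofx0.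
(* With this [eps] the lower level [phi x - eps] is [cc]. *)
exists U, (psi x0 - cc); split.
- have n1 : \forall y \near x, chart_dom c y.
    by apply: open_nbhs_nbhs; split => //; exact: chart_dom_open.
  have n2 : \forall y \near x, ball (0 : 'rV[R]_d) 1 (f y).
    have fx : {for x, continuous f} by exact: fc.
    by apply: fx; rewrite /f -/x0 S0; exact: nbhsx_ballx.
  by apply: filterS2 n1 n2.
- exists f, g; split => //.
    by apply: continuous_in_subspaceT => y; rewrite inE => -[cy _]; exact: fc.
  by apply: continuous_in_subspaceT => z; rewrite inE => Bz; exact: gc.
- by rewrite subr_gt0.
rewrite phixE subKr.
apply: (@flow_box_retract R d i0 M U f g phi cc (psi x0 + (psi x0 - cc))) => //.
- by move=> y [cy _]; exact: fc.
- move=> z Bz.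
  apply: (@continuous_comp _ _ _ T psi); first exact: box_map_continuous.
  by apply: cphi; exact: TB.
- move=> z s Bz s0 Bzs; rewrite /g /T box_mapD; apply: mono.
  + exact: TB.
  + by rewrite mulr_gt0.
  + by rewrite -box_mapD; exact: TB.
- move=> z Bz zi; apply: (he1 (T z)); rewrite -ball_normE/=.
  exact: lt_le_trans (Tdist z _ Bz zi) bN2.
- move=> z Bz zi; apply: (he2 (T z)); rewrite -ball_normE/=.
  exact: lt_le_trans (Tdist z _ Bz zi) bN3.
- by rewrite (le_trans (ltW cc2))// lerDl subr_ge0 ltW.
Qed.

(** * Smooth families on manifolds *)

Section TangentRange.
Variables (R : realType) (K : base_field) (d : nat) (M : smooth_manifold R d) (n : nat).
Local Notation F := (scalarF R K).
Local Notation C := R[i].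

Lemma conjF_mkF (a b : R) : conjF (mkF K a b) = mkF K a (- b).
Proof. by case: K. Qed.

Lemma mkF_lin (t a b a' b' : R) :
  mkF K (t * a + a') (t * b + b') = realF K t * mkF K a b + mkF K a' b'.
Proof.
by case: K => //=; apply/eqP; rewrite eq_complex/= !mul0r subr0 addr0 !eqxx.
Qed.

(** Over the reals [imF] is constantly 0, so the component dropped by [mkF] is a zero
    differential. *)
Lemma cplF_mkF_diff (V : normedModType R) (f : V -> F) (u v : V) (a : R) :
  cplF (mkF K a ('d (fun y => imF (f y)) u v)) =
  Complex a ('d (fun y => imF (f y)) u v).
Proof.
case: K f => f //=; rewrite /cplF/=; congr Complex.
by rewrite [in RHS](_ : (fun y => _) = cst 0)// diff_cst.
Qed.

Variable (A : M -> 'M[F]_n).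
Hypothesis hA : smooth_family A.

Lemma family_diff (c : chart R d M) i j u : atlas c -> chart_cod c u ->
  differentiable (fun y => reF (A (of_chart c y) i j)) u /\
  differentiable (fun y => imF (A (of_chart c y) i j)) u.
Proof.
move=> ac cu; have [h1 h2] := hA.2 i j.
by split; [exact: (h1 c ac 1%N).1|exact: (h2 c ac 1%N).1].
Qed.

Lemma family_C1 (c : chart R d M) i j u v : atlas c -> chart_cod c u ->
  {for u, continuous (fun y => 'D_v (fun y => reF (A (of_chart c y) i j)) y)} /\
  {for u, continuous (fun y => 'D_v (fun y => imF (A (of_chart c y) i j)) y)}.
Proof.
move=> ac cu; have [h1 h2] := hA.2 i j.
by split; [exact: ((h1 c ac 1%N).2 v)|exact: ((h2 c ac 1%N).2 v)].
Qed.

Lemma SymF_entry (y : M) i j : A y i j = conjF (A y j i).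
Proof. by have /matrixP/(_ i j) := hA.1 y; rewrite !mxE. Qed.

Variable x : M.
Let c := chart_at x.

Lemma chart_atP : atlas c /\ chart_dom c x.
Proof. exact: (svalP (cid (atlas_cover x))). Qed.

Lemma chart_at_cod : chart_cod c (to_chart c x).
Proof.
have [toP _ _ _] := chart_homeo c.
by have [] := toP x chart_atP.2.
Qed.

Lemma differentialN (f : M -> R) (w : chart R d M -> 'rV[R]_d) :
  differentiable (f \o of_chart c) (to_chart c x) ->
  differential (fun y => - f y) x w = - differential f x w.
Proof.
move=> df; rewrite /differential -/c.
have -> : (fun y => - f y) \o of_chart c = - (f \o of_chart c) by [].
by rewrite diffN.
Qed.

Lemma family_differential_SymF w : SymF (family_differential A x w).
Proof.
rewrite /SymF/=; apply/matrixP => i j; rewrite !mxE conjF_mkF.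
have [dre dim] := family_diff i j chart_atP.1 chart_at_cod.
have -> : (fun y => reF (A y j i)) = (fun y => reF (A y i j)).
  by apply/funext => y; rewrite SymF_entry reF_conj.
have -> : (fun y => imF (A y j i)) = (fun y => - imF (A y i j)).
  by apply/funext => y; rewrite SymF_entry imF_conj.
by rewrite differentialN// opprK.
Qed.

Lemma differential_lin (f : M -> R) t (w w' : chart R d M -> 'rV[R]_d) :
  differential f x (fun c => t *: w c + w' c) =
  t * differential f x w + differential f x w'.
Proof. exact: linearP. Qed.

Lemma family_differential_lin t w w' :
  family_differential A x (fun c => t *: w c + w' c) =
  realF K t *: family_differential A x w + family_differential A x w'.
Proof.
by apply/matrixP => i j; rewrite !mxE !differential_lin mkF_lin.
Qed.

Variables (nu : nat) (U : 'M[F]_(n, nu)).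

Lemma cplmx_Hop w : cplmx (Hop A x U w) =
  hadj (cplmx U) *m cplmx (family_differential A x w) *m cplmx U.
Proof. by rewrite /Hop !cplmxM cplmx_adjoint. Qed.

Lemma RanH_SymF : RanH A x U `<=` @SymF R K nu.
Proof.
move=> _ [w _ <-]; apply: cplmx_inj; rewrite cplmx_adjoint cplmx_Hop.
by rewrite !hadjM hadjK cplmx_herm ?mulmxA//; exact: family_differential_SymF.
Qed.

Lemma RanH_lin t X Y : RanH A x U X -> RanH A x U Y ->
  RanH A x U (realF K t *: X + Y).
Proof.
move=> [w [w0 wT] <-] [w' [w'0 w'T] <-].
exists (fun c => t *: w c + w' c); last first.
  rewrite /Hop family_differential_lin mulmxDr mulmxDl.
  by rewrite -scalemxAr -scalemxAl.
split=> [e ne|e e' he he']; first by rewrite w0// w'0// scaler0 addr0.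
by rewrite (wT e e' he he') (w'T e e' he he') linearP.
Qed.

Lemma RanH0 : RanH A x U 0.
Proof.
exists (fun=> 0); last first.
  have -> : (fun=> 0) = (fun c : chart R d M => (0 : R) *: (0 : 'rV[R]_d) + 0).
    by apply/funext => ?; rewrite scale0r addr0.
  rewrite /Hop family_differential_lin.
  have -> : realF K 0 = 0 by case: K.
  rewrite scale0r add0r.
  suff -> : family_differential A x (fun=> 0) = 0 by rewrite mulmx0 mul0mx.
  apply/matrixP => i j; rewrite !mxE /differential !linear0.
  by case: K.
by split=> // e e' _ _; rewrite linear0.
Qed.

(** Needed because forms are tested on complex vectors. For a real matrix and a real eigenvalue, the
    real and imaginary parts of a complex eigenvector are eigenvectors too, and [U] reaches each of
    them. *)
Lemma eigenspace_range (B : 'M[F]_n) (a : R) (w : 'cV[C]_n) :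
  isometry_onto U (right_eigenspace B a) ->
  cplmx B *m w = a%:C%C *: w -> exists u, w = cplmx U *m u.
Proof.
move=> [_ /seteqP[_ hU]] hw.
suff h : exists w1 w2 : 'cV[F]_n, [/\ w = cplmx w1 + 'i *: cplmx w2,
    right_eigenspace B a w1 & right_eigenspace B a w2].
  have [w1 [w2 [-> /hU[u1 _ <-] /hU[u2 _ <-]]]] := h.
  exists (cplmx u1 + 'i *: cplmx u2).
  by rewrite mulmxDr -scalemxAr !cplmxM.
clear hU; case: K B hw => B hw.
  exists (map_mx (@complex.Re R) w), (map_mx (@complex.Im R) w); split.
  - apply/colP => i; rewrite !mxE; case: (w i 0) => p q; apply/eqP.
    by rewrite eq_complex/= ?(mul0r, mul1r, mulr0, subr0, addr0, add0r) !eqxx.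
  - apply/colP => i; have /colP/(_ i)/(congr1 (@complex.Re R)) := hw.
    rewrite !mxE Re_sum ReZ /= => <-; apply: eq_bigr => j _.
    by rewrite !mxE; case: (w j 0) => p q /=; rewrite mul0r subr0.
  - apply/colP => i; have /colP/(_ i)/(congr1 (@complex.Im R)) := hw.
    rewrite !mxE.
    have -> : complex.Im (a%:C%C * w i 0) = a * complex.Im (w i 0).
      by case: (w i 0) => p q /=; rewrite mul0r addr0.
    rewrite (big_morph (@complex.Im R) (id1 := 0) (op1 := +%R)) => [<-| |//].
      apply: eq_bigr => j _.
      by rewrite !mxE; case: (w j 0) => p q /=; rewrite mul0r addr0.
    by move=> [? ?] [? ?].
have cplE m (X : 'M[R[i]]_(n, m)) : @cplmx R BaseC n m X = X.
  by apply/matrixP => i j; rewrite mxE /cplF/=; case: (X i j).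
exists w, 0; split; first by rewrite cplmx0 scaler0 addr0 cplE.
  by move: hw; rewrite cplE.
by rewrite /right_eigenspace/= mulmx0 scaler0.
Qed.

End TangentRange.

Theorem theorem1p5 (R : realType) (K : base_field) (d : nat)
    (M : smooth_manifold R d) (n : nat) (A : M -> 'M[scalarF R K]_n)
    (hA : smooth_family A) (k : 'I_n) (x : M) (nu : nat)
    (hnu : (1 <= nu)%N) (hmult : multiplicity (A x) (lambda A k x) = nu)
    (U : 'M[scalarF R K]_(n, nu))
    (hU : isometry_onto U (right_eigenspace (A x) (lambda A k x))) :
  ((exists X, RanH A x U X /\ posdef X) <->
   frobenius_orth (RanH A x U) `&` @SymF_plus R K nu = [set 0]) /\
  ((exists X, RanH A x U X /\ posdef X) ->
   topologically_regular (lambda A k) x).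
Proof.
split.
  (* Positive multiplicity gives the size [nu.+1] required by the alternative. *)
  clear hmult; case: nu hnu U hU => // nu _ U hU.
  apply: posdef_alternative.
  - exact: RanH_SymF.
  - exact: RanH0.
  - by move=> t X Y; exact: RanH_lin.
move=> [_ [[w _ <-] Xpos]].
have /(posdefP Xpos.1) Xq := Xpos.
pose c := chart_at x; pose v := w c; pose x0 := to_chart c x.
have [ac cx] := chart_atP x; rewrite -/c in ac cx.
have cx0 : chart_cod c x0 by exact: chart_at_cod.
have ofx0 : of_chart c x0 = x by have [toP _ _ _] := chart_homeo c; exact: (toP x cx).2.
pose Ah u := A (of_chart c u).
pose D0 : 'M[R[i]]_n := \matrix_(i, j)
  Complex ('D_v (fun y => reF (Ah y i j)) x0) ('D_v (fun y => imF (Ah y i j)) x0).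
have D0E : D0 = cplmx (family_differential A x w).
  apply/matrixP => i j; rewrite !mxE /differential -/c -/v -/x0.
  have [dre dim] := family_diff hA i j ac cx0.
  by rewrite !deriveE// -cplF_mkF_diff.
(* A zero direction would give a zero matrix in the range, which is not positive definite in
   positive size. *)
have v0 : v != 0.
  apply/eqP => v0; have := Xq (delta_mx 0 (Ordinal hnu)).
  have -> : cplmx (Hop A x U w) = 0.
    rewrite cplmx_Hop -D0E.
    suff -> : D0 = 0 by rewrite mulmx0 mul0mx.
    apply/matrixP => i j; rewrite !mxE.
    have [dre dim] := family_diff hA i j ac cx0.
    by rewrite !deriveE// v0 !linear0.
  rewrite qf0 ltxx => h; suff : false by []; apply: h.
  apply/eqP => /matrixP/(_ 0 (Ordinal hnu)); rewrite !mxE !eqxx/= => /eqP.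
  by rewrite oner_eq0.
have lamE : lambda_hat (Ah x0) k = lambda A k x by rewrite /Ah ofx0.
have Ocod : nbhs x0 (chart_cod c).
  by apply: open_nbhs_nbhs; split=> //; exact: chart_cod_open.
have [|r [r0 BO mono]] := @lambda_hat_increasing R _ K n Ah k x0 v (chart_cod c)
  Ocod v0 (fun y => hA.1 _)
  (fun i j y hy => (family_diff hA i j ac hy).1)
  (fun i j y hy => (family_diff hA i j ac hy).2)
  (fun i j => (family_C1 hA i j v ac cx0).1)
  (fun i j => (family_C1 hA i j v ac cx0).2) _.
  rewrite -/D0 lamE /Ah ofx0 => z z0 hz.
  (* Forms take rows while eigenspaces consist of columns; the adjoint passes from one to the
     other. *)
  have hz' : cplmx (A x) *m hadj z = (lambda A k x)%:C%C *: hadj z.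
    rewrite -[in LHS](cplmx_herm (hA.1 x)) -hadjM -hadjZ; congr hadj.
    by move: hz; rewrite mulmxBr mul_mx_scalar => /subr0_eq.
  have [u uE] := eigenspace_range hU hz'.
  have zE : z = hadj u *m hadj (cplmx U) by rewrite -hadjM -uE hadjK.
  (* On the eigenspace the form of [D0] at [z] is the form of [Hop A x U w] at [hadj u], which is
     positive. *)
  rewrite zE -qf_mulmx hadjK D0E -cplmx_Hop; apply: Xq.
  by apply: contra z0 => /eqP e; rewrite zE e mul0mx.
apply: (topologically_regular_increasing cx v0 r0 BO) => // u /BO cu.
apply: lambda_hat_continuous => [y|i j|i j]; first exact: hA.1.
  exact: (differentiable_continuous (family_diff hA i j ac cu).1).
exact: (differentiable_continuous (family_diff hA i j ac cu).2).
Qed.
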